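(* There exists a centrally symmetric convex $4$-polytope $P$ such that for every $4$-dimensional Hanner polytope $H$ there is a functional $\alpha \in \mathcal{F}_4$ with $\alpha(P) < \alpha(H)$. (That is, the following statement fails for $d=4$: for every centrally symmetric $d$-polytope $P$ there is a $d$-dimensional Hanner polytope $H$ with $\alpha(P)\ge\alpha(H)$ for all $\alpha\in\mathcal{F}_d$.)
   Context: For a $d$-polytope $P$ and $S=\{i_1<i_2<\dots<i_k\}\subseteq\{0,1,\dots,d-1\}$, the flag number $f_S(P)$ is the number of chains of faces $F_1\subset F_2\subset\cdots\subset F_k\subset P$ with $\dim F_j=i_j$ for all $j$. For $\alpha=(\alpha_S)_{S\subseteq\{0,\dots,d-1\}}\in\mathbb{R}^{2^{\{0,\dots,d-1\}}}$ write $\alpha(P)=\sum_S\alpha_S f_S(P)$. Let $\mathcal{F}_d$ be the set of all such $\alpha$ with $\alpha(P)\ge 0$ for all (not necessarily centrally symmetric) convex $d$-polytopes $P$. A polytope $P$ is centrally symmetric if $P=-P$. Hanner polytopes are defined recursively: every centrally symmetric $1$-dimensional polytope is a Hanner polytope; for $d\ge 2$, a $d$-polytope is a Hanner polytope if it is the direct sum $H'\oplus H''=\mathrm{conv}(H'\times\{0\}\cup\{0\}\times H'')$ or the direct product $H'\times H''$ of two lower-dimensional Hanner polytopes $H',H''$. *)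

(* Defs.v *)
From HB Require Import structures.
From mathcomp Require Import all_boot all_order all_algebra finmap.
From mathcomp Require Import all_classical reals.

Set Implicit Arguments.
Unset Strict Implicit.
Unset Printing Implicit Defensive.

Import Order.TTheory GRing.Theory Num.Theory.

Local Open Scope classical_set_scope.
Local Open Scope ring_scope.

Section Polytopes.
Variable R : realType.

Definition convex_hull (n : nat) (A : set 'rV[R]_n) : set 'rV[R]_n :=
  [set x | exists (k : nat) (p : 'I_k -> 'rV[R]_n) (l : 'I_k -> R),
    [/\ forall i, A (p i), forall i, 0 <= l i, \sum_i l i = 1
      & x = \sum_i l i *: p i]].

Definition affine_hull (n : nat) (A : set 'rV[R]_n) : set 'rV[R]_n :=
  [set x | exists (k : nat) (p : 'I_k -> 'rV[R]_n) (l : 'I_k -> R),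
    [/\ forall i, A (p i), \sum_i l i = 1 & x = \sum_i l i *: p i]].

(* The empty set (dimension -1 by convention) satisfies [has_dim] for no k. *)
Definition has_dim (n : nat) (A : set 'rV[R]_n) (k : nat) : Prop :=
  exists (x0 : 'rV[R]_n) (U : {vspace 'rV[R]_n}),
    affine_hull A = [set x | x - x0 \in U] /\ \dim U = k.

Definition is_polytope (n : nat) (P : set 'rV[R]_n) : Prop :=
  exists V : set 'rV[R]_n, finite_set V /\ P = convex_hull V.

(* The ambient dimension n may exceed d. *)
Definition is_dpolytope (d n : nat) (P : set 'rV[R]_n) : Prop :=
  is_polytope P /\ has_dim P d.

Definition centrally_symmetric (n : nat) (P : set 'rV[R]_n) : Prop :=
  P = [set - x | x in P].

Definition dotv (n : nat) (c x : 'rV[R]_n) : R := \sum_i c 0 i * x 0 i.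

(* c = 0 is allowed, so the empty set and P itself are faces of P. *)
Definition is_face (n : nat) (P F : set 'rV[R]_n) : Prop :=
  exists (c : 'rV[R]_n) (b : R),
    (forall x, P x -> dotv c x <= b) /\ F = P `&` [set x | dotv c x = b].

(* [enum_val j] is the j-th smallest element of S. *)
Definition flags (d n : nat) (S : {set 'I_d}) (P : set 'rV[R]_n) :
    set (#|S|.-tuple (set 'rV[R]_n)) :=
  [set c | [/\ forall j : 'I_#|S|,
                 is_face P (tnth c j) /\ has_dim (tnth c j) (enum_val j),
               forall i j : 'I_#|S|, (i < j)%N -> tnth c i `<` tnth c j
             & forall j : 'I_#|S|, tnth c j `<` P]].

Arguments flags {d n} S P.

(* [fset_set] of an infinite set is empty, but a polytope has only finitely
   many faces, hence finitely many flags. *)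
Definition flag_number (d n : nat) (S : {set 'I_d}) (P : set 'rV[R]_n) : nat :=
  #|` fset_set (flags S P) |%fset.

Definition flag_functional (d : nat) (alpha : {set 'I_d} -> R)
    (n : nat) (P : set 'rV[R]_n) : R :=
  \sum_(S : {set 'I_d}) alpha S * (flag_number S P)%:R.

Definition nonneg_functionals (d : nat) : set ({set 'I_d} -> R) :=
  [set alpha | forall (n : nat) (P : set 'rV[R]_n),
     is_dpolytope d P -> 0 <= flag_functional alpha P].

Definition direct_product (m n : nat)
    (A : set 'rV[R]_m) (B : set 'rV[R]_n) : set 'rV[R]_(m + n) :=
  [set row_mx x y | x in A & y in B].

Definition direct_sum (m n : nat)
    (A : set 'rV[R]_m) (B : set 'rV[R]_n) : set 'rV[R]_(m + n) :=
  convex_hull ([set row_mx x 0 | x in A] `|` [set row_mx 0 y | y in B]).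

(* Dimensions add up under both operations, so the two summands or factors
   automatically have lower dimension than the result. *)
Inductive hanner : forall n : nat, set 'rV[R]_n -> Prop :=
| hanner_segment (n : nat) (P : set 'rV[R]_n) :
    is_dpolytope 1 P -> centrally_symmetric P -> hanner P
| hanner_direct_sum (m n : nat) (H1 : set 'rV[R]_m) (H2 : set 'rV[R]_n) :
    hanner H1 -> hanner H2 -> hanner (direct_sum H1 H2)
| hanner_direct_product (m n : nat) (H1 : set 'rV[R]_m) (H2 : set 'rV[R]_n) :
    hanner H1 -> hanner H2 -> hanner (direct_product H1 H2).

End Polytopes.

Arguments flags {R d n} S P.
Arguments nonneg_functionals {R} d.

(* Main.v *)
(** Take P to be the convex hull of +-e_1, ..., +-e_4 and +-(1/2, 1/2, 1/2, 1/2):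
    the two extra points lie beyond two opposite facets of the cross polytope and
    on the hyperplanes of the neighbouring facets.  All 2-faces of P are triangles
    and P has only 14 facets (the bound 15 is enough).

    Two functionals in F_4 suffice: f_3, and f_02 - 3 f_2, which is nonnegative
    because every 2-face has at least three vertices and which vanishes on P.  A
    Hanner polytope of dimension d >= 3 that is a product has a parallelogram, the
    product of two edges, as a 2-face.  A direct sum inherits the proper
    non-triangular 2-faces of its summands, and its number of facets is the product
    of those of the summands.  Hence a 4-dimensional Hanner polytope either has a
    2-face with four vertices, so that f_02 - 3 f_2 is positive on it, or has at
    least 2^4 = 16 facets. *)

Require Import Defs.
From HB Require Import structures.
From mathcomp Require Import all_boot all_order all_algebra finmap.
From mathcomp Require Import all_classical reals.
From mathcomp Require Import ring lra.
Import Order.TTheory GRing.Theory Num.Theory.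
Local Open Scope classical_set_scope.
Local Open Scope ring_scope.

Set Implicit Arguments.
Unset Strict Implicit.
Unset Printing Implicit Defensive.

(** * The dot product *)

Section DotProduct.
Variables (R : realType) (n : nat).
Implicit Types (c x y : 'rV[R]_n) (a : R).

Lemma dotvDr c x y : dotv c (x + y) = dotv c x + dotv c y.
Proof. by rewrite /dotv -big_split; apply: eq_bigr => i _; rewrite mxE mulrDr. Qed.

Lemma dotvZr c a x : dotv c (a *: x) = a * dotv c x.
Proof. by rewrite /dotv mulr_sumr; apply: eq_bigr => i _; rewrite mxE mulrCA. Qed.

Lemma dotvNr c x : dotv c (- x) = - dotv c x.
Proof. by rewrite -scaleN1r dotvZr mulN1r. Qed.

Lemma dotvBr c x y : dotv c (x - y) = dotv c x - dotv c y.
Proof. by rewrite dotvDr dotvNr. Qed.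

Lemma dotv0r c : dotv c 0 = 0.
Proof. by rewrite -(scale0r 0) dotvZr mul0r. Qed.

Lemma dotvC c x : dotv c x = dotv x c.
Proof. by apply: eq_bigr => i _; rewrite mulrC. Qed.

Lemma dotvDl c x y : dotv (x + y) c = dotv x c + dotv y c.
Proof. by rewrite dotvC dotvDr !(dotvC c). Qed.

Lemma dotvZl c a x : dotv (a *: x) c = a * dotv x c.
Proof. by rewrite dotvC dotvZr (dotvC c). Qed.

Lemma dotvNl c x : dotv (- x) c = - dotv x c.
Proof. by rewrite dotvC dotvNr (dotvC c). Qed.

Lemma dotv0l c : dotv 0 c = 0.
Proof. by rewrite dotvC dotv0r. Qed.

Lemma dotv_sumr c (I : Type) (r : seq I) (F : I -> 'rV[R]_n) :
  dotv c (\sum_(i <- r) F i) = \sum_(i <- r) dotv c (F i).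
Proof. by apply: (big_morph (dotv c)); [exact: dotvDr | exact: dotv0r]. Qed.

Lemma dotv_ge0 x : 0 <= dotv x x.
Proof. by apply: sumr_ge0 => i _; rewrite -expr2 sqr_ge0. Qed.

Lemma dotv_eq0 x : dotv x x = 0 -> x = 0.
Proof.
move=> /eqP; rewrite psumr_eq0; last by move=> i _; rewrite -expr2 sqr_ge0.
move=> /allP x0; apply/rowP => i; rewrite mxE.
by have := x0 i (mem_index_enum _); rewrite /= mulf_eq0 orbb => /eqP.
Qed.

Lemma dotv_delta x i : dotv (delta_mx 0 i) x = x 0 i.
Proof.
rewrite /dotv (bigD1 i) //= mxE !eqxx mul1r big1 ?addr0 // => j ji.
by rewrite mxE eqxx (negbTE ji) mul0r.
Qed.

(** The residual [x - projv U x] vanishes on [U] and is nonzero at [u], so one of its coordinates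
    separates; [c] represents that coordinate as a dot product. *)
Lemma functional_separating (U : {vspace 'rV[R]_n}) u : u \notin U ->
  exists c, (forall x, x \in U -> dotv c x = 0) /\ dotv c u != 0.
Proof.
move=> uU; pose f x := x - projv U x.
have fu : f u != 0.
  by apply: contraNN uU; rewrite subr_eq0 => /eqP ->; rewrite memv_proj.
have /existsP[j fuj] : [exists j, f u 0 j != 0].
  apply: contraNT fu; rewrite negb_exists => /forallP f0.
  by apply/eqP/rowP => j; rewrite [RHS]mxE; have := f0 j; rewrite negbK => /eqP.
pose c := \row_i (f (delta_mx 0 i) 0 j).
have cE x : dotv c x = f x 0 j.
  rewrite {2}(row_sum_delta x) /f linear_sum /= -sumrB summxE.
  by apply: eq_bigr => i _; rewrite /c mxE linearZ -scalerBr [RHS]mxE mulrC.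
exists c; split; last by rewrite cE.
by move=> x xU; rewrite cE /f projv_id // subrr mxE.
Qed.

End DotProduct.

Lemma dotv_row_mx (R : realType) m n (c x : 'rV[R]_m) (d y : 'rV[R]_n) :
  dotv (row_mx c d) (row_mx x y) = dotv c x + dotv d y.
Proof.
rewrite /dotv big_split_ord; congr (_ + _); apply: eq_bigr => i _.
  by rewrite !row_mxEl.
by rewrite !row_mxEr.
Qed.

(** * Convex hulls *)

Section ConvexHull.
Variable R : realType.

Definition is_convex n (A : set 'rV[R]_n) :=
  forall x y (t : R), A x -> A y -> 0 <= t <= 1 -> A (t *: x + (1 - t) *: y).

Section FixedDimension.
Variable n : nat.
Implicit Types (A B V : set 'rV[R]_n) (c x y : 'rV[R]_n).

Lemma is_convex_sum A : is_convex A ->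
  forall k (p : 'I_k -> 'rV[R]_n) (l : 'I_k -> R),
  (forall i, A (p i)) -> (forall i, 0 <= l i) -> \sum_i l i = 1 ->
  A (\sum_i l i *: p i).
Proof.
move=> cA; elim=> [|k IH] p l Ap l0 l1.
  by move: l1; rewrite big_ord0 => /eqP; rewrite eq_sym oner_eq0.
rewrite big_ord_recl; rewrite big_ord_recl in l1.
set s := \sum_(i < k) l (lift ord0 i) in l1.
have s0 : 0 <= s by apply: sumr_ge0.
(* If the remaining weights sum to zero, they all vanish; otherwise they are divided by [s] before
   the induction hypothesis is applied. *)
have [s00|sN0] := eqVneq s 0.
  have z i : l (lift ord0 i) = 0.
    move/eqP: s00; rewrite psumr_eq0; last by [].
    by move=> /allP /(_ i (mem_index_enum _)) /eqP.
  rewrite big1 ?addr0; last by move=> i _; rewrite z scale0r.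
  by move: l1; rewrite s00 addr0 => ->; rewrite scale1r.
have -> : \sum_(i < k) l (lift ord0 i) *: p (lift ord0 i) =
  (1 - l ord0) *: \sum_(i < k) (l (lift ord0 i) / s) *: p (lift ord0 i).
  rewrite scaler_sumr; apply: eq_bigr => i _; rewrite scalerA; congr (_ *: _).
  by rewrite -l1 addrC addKr mulrCA divff ?mulr1.
apply: cA => //.
- apply: IH => // [i|]; first by rewrite divr_ge0.
  by rewrite -mulr_suml divff.
- by rewrite l0 -l1 lerDl.
Qed.

Lemma convex_hull_convex A : is_convex (convex_hull A).
Proof.
move=> x y t [k1 [p1 [l1 [Ap1 l10 l11 ->]]]] [k2 [p2 [l2 [Ap2 l20 l21 ->]]]].
move=> /andP[t0 t1].
exists (k1 + k2)%N,
  (fun i => match fintype.split i with inl a => p1 a | inr b => p2 b end),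
  (fun i => match fintype.split i with
            | inl a => t * l1 a | inr b => (1 - t) * l2 b end).
split.
- by move=> i; case: fintype.split.
- by move=> i; case: fintype.split => j; rewrite mulr_ge0 ?subr_ge0.
- rewrite big_split_ord /=.
  under eq_bigr do rewrite (unsplitK (inl _)).
  under [X in _ + X]eq_bigr do rewrite (unsplitK (inr _)).
  by rewrite -!mulr_sumr l11 l21 !mulr1 addrC subrK.
- rewrite big_split_ord /=.
  under [in RHS]eq_bigr do rewrite (unsplitK (inl _)) -scalerA.
  under [X in _ = _ + X]eq_bigr do rewrite (unsplitK (inr _)) -scalerA.
  by rewrite -!scaler_sumr.
Qed.

Lemma sub_convex_hull A : A `<=` convex_hull A.
Proof.
move=> x Ax; exists 1%N, (fun=> x), (fun=> 1); split => //.
- by rewrite big_ord1.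
- by rewrite big_ord1 scale1r.
Qed.

Lemma convex_hull_nonempty A x : convex_hull A x -> exists y, A y.
Proof.
move=> [[|k] [p [l [Ap _ l1 _]]]]; last by exists (p ord0).
by move: l1; rewrite big_ord0 => /eqP; rewrite eq_sym oner_eq0.
Qed.

Lemma convex_hull_min A B : is_convex B -> A `<=` B -> convex_hull A `<=` B.
Proof.
move=> cB AB x [k [p [l [Ap l0 l1 ->]]]].
by apply: is_convex_sum => // i; apply: AB.
Qed.

Lemma convex_hull_mono A B : A `<=` B -> convex_hull A `<=` convex_hull B.
Proof.
move=> AB; apply: convex_hull_min; first exact: convex_hull_convex.
by apply: subset_trans AB _; apply: sub_convex_hull.
Qed.

Lemma convex_hull_id A : is_convex A -> convex_hull A = A.
Proof.
by move=> cA; apply/seteqP; split;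
  [apply: convex_hull_min | apply: sub_convex_hull].
Qed.

Lemma is_convex_halfspace c (b : R) : is_convex [set x | dotv c x <= b].
Proof.
move=> x y t /= xb yb /andP[t0 t1]; rewrite dotvDr !dotvZr.
have s0 : 0 <= 1 - t by rewrite subr_ge0.
nra.
Qed.

Lemma is_convex_hyperplane c (b : R) : is_convex [set x | dotv c x = b].
Proof. by move=> x y t /= xb yb _; rewrite dotvDr !dotvZr xb yb; ring. Qed.

Lemma is_convex_set1 x : is_convex [set x].
Proof. by move=> y z t /= -> -> _; rewrite -scalerDl addrC subrK scale1r. Qed.

Lemma is_convex_opp A : is_convex A -> is_convex [set x | A (- x)].
Proof. by move=> cA x y t /= Ax Ay t01; rewrite opprD -!scalerN; apply: cA. Qed.

Lemma is_convex_subspace (U : {vspace 'rV[R]_n}) : is_convex [set x | x \in U].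
Proof. by move=> x y t /= xU yU _; rewrite memvD ?memvZ. Qed.

(** A weighted average of values at most [b] equals [b] only if every point of nonzero weight
    attains [b]. *)
Lemma convex_hull_face V c (b : R) : (forall x, V x -> dotv c x <= b) ->
  convex_hull V `&` [set x | dotv c x = b] =
  convex_hull (V `&` [set x | dotv c x = b]).
Proof.
move=> Vb; apply/seteqP; split => x; last first.
  move=> Cx; split; first by apply: convex_hull_mono Cx => y [].
  by apply: (convex_hull_min (@is_convex_hyperplane c b)) Cx => y [].
case=> -[k [p [l [Vp l0 l1 xE]]]] /= cx.
have z i : l i * (b - dotv c (p i)) = 0.
  have : \sum_i l i * (b - dotv c (p i)) = 0.
    under eq_bigr do rewrite mulrBr.
    rewrite sumrB -mulr_suml l1 mul1r -cx xE dotv_sumr.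
    by apply/eqP; rewrite subr_eq0; apply/eqP/eq_bigr => j _; rewrite dotvZr.
  move/eqP; rewrite psumr_eq0 => [|j _]; last by rewrite mulr_ge0 ?subr_ge0 ?Vb.
  by move=> /allP /(_ i (mem_index_enum _)) /eqP.
have W i : l i != 0 -> (V `&` [set x | dotv c x = b]) (p i).
  move=> li; split => //=; have /eqP := z i.
  by rewrite mulf_eq0 (negbTE li) subr_eq0 /= => /eqP.
have /existsP[i0 li0] : [exists i, l i != 0].
  apply: contraT; rewrite negb_exists => /forallP l00.
  move: l1; rewrite big1 => [/eqP|i _]; first by rewrite eq_sym oner_eq0.
  by have := l00 i; rewrite negbK => /eqP.
(* Points of zero weight may lie off the hyperplane, so they are replaced by [p i0], whose weight is
   nonzero. *)
exists k, (fun i => if l i == 0 then p i0 else p i), l; split => //.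
- by move=> i; case: ifPn => [_|]; apply: W.
- by rewrite xE; apply: eq_bigr => i _; case: eqP => // ->; rewrite !scale0r.
Qed.

End FixedDimension.

Lemma is_convex_preimage m n (f : 'rV[R]_m -> 'rV[R]_n) (A : set 'rV[R]_n) :
  (forall x y t, f (t *: x + (1 - t) *: y) = t *: f x + (1 - t) *: f y) ->
  is_convex A -> is_convex (f @^-1` A).
Proof. by move=> fE cA x y t /= Ax Ay t01; rewrite /preimage /= fE; apply: cA. Qed.

End ConvexHull.

(** * Linear spans and dimension *)

Section LinearSpan.
Variable R : realType.

(** A finite part of [A] whose span has maximal dimension works, since adjoining one more point of
    [A] cannot enlarge the span. *)
Lemma finite_spanning n (A : set 'rV[R]_n) : exists X : seq 'rV[R]_n,
  (forall x, x \in X -> A x) /\ forall x, A x -> x \in <<X>>%VS.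
Proof.
pose good m := `[< exists X : seq 'rV[R]_n,
  (forall x, x \in X -> A x) /\ \dim <<X>>%VS = m >].
have g0 : exists m, good m.
  by exists 0%N; apply/asboolP; exists [::]; rewrite span_nil dimv0.
have gb m : good m -> (m <= \dim (fullv : {vspace 'rV[R]_n}))%N.
  by move=> /asboolP[X [_ <-]]; rewrite dimvS ?subvf.
case: (ex_maxnP g0 gb) => m /asboolP[X [XA dX]] mmax.
exists X; split=> // x Ax; have XxA : good (\dim <<x :: X>>%VS).
  apply/asboolP; exists (x :: X); split => // y; rewrite inE.
  by move=> /orP[/eqP ->|/XA].
have sXx : (<<X>> <= <<x :: X>>)%VS.
  by apply: sub_span => y yX; rewrite inE yX orbT.
have := dimv_leqif_sup sXx; rewrite dX => /leqifP.
case: ifPn => [sub _|_]; last by rewrite ltnNge mmax.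
by apply: (subvP sub); rewrite memv_span // mem_head.
Qed.

(** [A] may be infinite while [<<_>>] takes a sequence, hence the chosen finite spanning part;
    [mem_lspan] and [lspan_min] characterise the result independently of that choice. *)
Definition lspan n (A : set 'rV[R]_n) : {vspace 'rV[R]_n} :=
  <<sval (cid (finite_spanning A))>>%VS.

Lemma lspanE n (A : set 'rV[R]_n) :
  exists2 X : seq 'rV[R]_n, (forall x, x \in X -> A x) & lspan A = <<X>>%VS.
Proof. by rewrite /lspan; case: cid => X [XA _] /=; exists X. Qed.

Lemma mem_lspan n (A : set 'rV[R]_n) x : A x -> x \in lspan A.
Proof. by rewrite /lspan; case: cid => X [_ h] /=; apply: h. Qed.

Lemma lspan_min n (A : set 'rV[R]_n) (U : {vspace 'rV[R]_n}) :
  (forall x, A x -> x \in U) -> (lspan A <= U)%VS.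
Proof.
by move=> AU; have [X XA ->] := lspanE A; apply/span_subvP => x /XA /AU.
Qed.

Lemma lspan_mono n (A B : set 'rV[R]_n) :
  A `<=` B -> (lspan A <= lspan B)%VS.
Proof. by move=> AB; apply: lspan_min => x /AB; apply: mem_lspan. Qed.

Lemma lspan_convex_hull n (A : set 'rV[R]_n) : lspan (convex_hull A) = lspan A.
Proof.
apply/eqP; rewrite eqEsubv; apply/andP; split; last first.
  by apply: lspan_mono; apply: sub_convex_hull.
apply: lspan_min => x; apply: (convex_hull_min (@is_convex_subspace _ _ _)) => y.
exact: mem_lspan.
Qed.

Lemma lspan_set0 n : lspan (@set0 'rV[R]_n) = 0%VS.
Proof. by apply/eqP; rewrite -subv0; apply: lspan_min. Qed.

Lemma lspan_set1 n (x : 'rV[R]_n) : lspan [set x] = <[x]>%VS.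
Proof.
apply/eqP; rewrite eqEsubv; apply/andP; split.
  by apply: lspan_min => y /= ->; rewrite memv_line.
by rewrite -memvE mem_lspan.
Qed.

Lemma lspan_image m n (f : 'Hom('rV[R]_m, 'rV[R]_n)) (A : set 'rV[R]_m) :
  lspan [set f x | x in A] = (f @: lspan A)%VS.
Proof.
apply/eqP; rewrite eqEsubv; apply/andP; split.
  by apply: lspan_min => _ [x Ax <-]; rewrite memv_img // mem_lspan.
have [X XA ->] := lspanE A; rewrite limg_span; apply/span_subvP => _ /mapP[x xX ->].
by apply: mem_lspan; exists x => //; apply: XA.
Qed.

Lemma lspanU n (A B : set 'rV[R]_n) : lspan (A `|` B) = (lspan A + lspan B)%VS.
Proof.
apply/eqP; rewrite eqEsubv subv_add; apply/and3P; split.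
- apply: lspan_min => x [Ax|Bx].
    by rewrite (subvP (addvSl _ _)) // mem_lspan.
  by rewrite (subvP (addvSr _ _)) // mem_lspan.
- by apply: lspan_mono => x; left.
- by apply: lspan_mono => x; right.
Qed.

Lemma dim_lspan_seq n (A : set 'rV[R]_n) (X : seq 'rV[R]_n) :
  (forall x, A x -> x \in X) -> (\dim (lspan A) <= size X)%N.
Proof.
move=> AX; apply: leq_trans (dim_span X); apply/dimvS/lspan_min => x /AX.
exact: memv_span.
Qed.

(** The two coordinate embeddings [f1] and [f2] are linear and injective, and their images meet only
    in 0. *)
Lemma dim_lspan_sum m n (A : set 'rV[R]_m) (B : set 'rV[R]_n) :
  \dim (lspan ([set row_mx x (0 : 'rV[R]_n) | x in A] `|`
               [set row_mx (0 : 'rV[R]_m) y | y in B])) =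
  (\dim (lspan A) + \dim (lspan B))%N.
Proof.
pose f1 : 'Hom('rV[R]_m, 'rV[R]_(m + n)) := linfun (mulmxr (row_mx 1%:M 0)).
pose f2 : 'Hom('rV[R]_n, 'rV[R]_(m + n)) := linfun (mulmxr (row_mx 0 1%:M)).
have f1E x : f1 x = row_mx x 0.
  by rewrite lfunE /= mul_mx_row mulmx1 mulmx0.
have f2E x : f2 x = row_mx 0 x.
  by rewrite lfunE /= mul_mx_row mulmx1 mulmx0.
under eq_imagel do rewrite -f1E.
under [X in _ `|` X]eq_imagel do rewrite -f2E.
rewrite lspanU !lspan_image dimv_disjoint_sum.
  rewrite !limg_dim_eq //; apply/eqP; rewrite -subv0; apply/subvP => x;
    rewrite memv_cap memv_ker memv0 ?f1E ?f2E => /andP[_].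
    by rewrite -row_mx0 => /eqP /eq_row_mx[_ ->].
  by rewrite -row_mx0 => /eqP /eq_row_mx[->].
apply/eqP; rewrite -subv0; apply/subvP => x; rewrite memv_cap memv0.
move=> /andP[/memv_imgP[u _ ->] /memv_imgP[v _]].
by rewrite f1E f2E => /eq_row_mx[-> _]; rewrite row_mx0.
Qed.

End LinearSpan.

Section Dimension.
Variables (R : realType) (n : nat).
Implicit Types (A : set 'rV[R]_n) (a c x : 'rV[R]_n).

Lemma has_dim_nonempty A k : has_dim A k -> exists a, A a.
Proof.
move=> [x0 [U [E _]]].
have [l [p [u [Ap u1 _]]]] : affine_hull A x0 by rewrite E /= subrr mem0v.
case: l p u Ap u1 => [|l] p u Ap u1; last by exists (p ord0).
by move: u1; rewrite big_ord0 => /eqP; rewrite eq_sym oner_eq0.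
Qed.

(** An affine combination minus [a] is a linear combination of differences. Conversely, putting the
    weight [1 - \sum_j l j] on [a] turns a linear combination of differences into an affine one. *)
Lemma affine_hullE A a : A a ->
  affine_hull A = [set x | x - a \in lspan [set y - a | y in A]].
Proof.
move=> Aa; apply/seteqP; split => x /=.
  move=> [k [p [l [Ap l1 ->]]]].
  have -> : a = \sum_i l i *: a by rewrite -scaler_suml l1 scale1r.
  rewrite -sumrB; apply: memv_suml => i _; rewrite -scalerBr memvZ //.
  by apply: mem_lspan; exists (p i) => //; rewrite -scaler_suml l1 scale1r.
have [X XA ->] := lspanE [set y - a | y in A].
move=> xX; pose l i := coord (in_tuple X) i (x - a).
have xE : x - a = \sum_i l i *: X`_i by exact: (@coord_span _ _ _ (in_tuple X)).
exists (size X).+1, (fun i => if unlift ord0 i is Some j then X`_j + a else a),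
  (fun i => if unlift ord0 i is Some j then l j else 1 - \sum_j l j); split.
- move=> i; case: unliftP => // j _.
  by have [y Ay <-] := XA _ (mem_nth 0 (ltn_ord j)); rewrite subrK.
- rewrite big_ord_recl unlift_none.
  under [X in _ + X = _]eq_bigr do rewrite liftK.
  by rewrite subrK.
- rewrite big_ord_recl unlift_none.
  under [X in _ = _ + X]eq_bigr do rewrite liftK scalerDr.
  rewrite big_split /= -xE -scaler_suml scalerBl scale1r.
  by rewrite addrACA addNr addr0 addrC subrK.
Qed.

(** The direction space of an affine subspace does not depend on the base point, so the pair [x0],
    [U] of [has_dim] can be traded for any point of [A]. *)
Lemma has_dimE A a k : A a ->
  has_dim A k <-> \dim (lspan [set y - a | y in A]) = k.
Proof.
move=> Aa; rewrite /has_dim (affine_hullE Aa); set L := lspan _; split.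
  move=> [x0 [U [E <-]]]; congr (\dim _).
  have aU : a - x0 \in U.
    have : [set x | x - a \in L] a by rewrite /= subrr mem0v.
    by rewrite E.
  apply/eqP; rewrite eqEsubv; apply/andP; split; apply/subvP => v vL.
    have : [set x | x - a \in L] (v + a) by rewrite /= addrK.
    by rewrite E /= -addrA rpredDr.
  have : [set x | x - x0 \in U] (v + a) by rewrite /= -addrA memvD.
  by rewrite -E /= addrK.
by move=> <-; exists a, L.
Qed.

Lemma has_dim_unique A k l : has_dim A k -> has_dim A l -> k = l.
Proof.
move=> Ak Al; have [a Aa] := has_dim_nonempty Ak.
by rewrite -((has_dimE k Aa).1 Ak) -((has_dimE l Aa).1 Al).
Qed.

Lemma has_dim0E A k : A 0 -> has_dim A k <-> \dim (lspan A) = k.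
Proof.
move=> A0; rewrite (has_dimE k A0); under eq_imagel do rewrite subr0.
by rewrite image_id.
Qed.

Lemma has_dim_set1 a : has_dim [set a] 0.
Proof.
apply/(@has_dimE _ a) => //; rewrite image_set1 subrr lspan_set1.
by rewrite -span_seq1 span_def big_seq1 dim_vline eqxx.
Qed.

Lemma has_dim0_set1 A : has_dim A 0 -> exists a, A = [set a].
Proof.
move=> A0; have [a Aa] := has_dim_nonempty A0.
have := (has_dimE 0 Aa).1 A0 => /eqP; rewrite dimv_eq0 => /eqP L0.
exists a; apply/seteqP; split => x //=; last by move=> ->.
move=> Ax; apply/eqP; rewrite -subr_eq0 -memv0 -L0.
by apply: mem_lspan; exists x.
Qed.

(* The hyperplane avoids the origin, so passing from affine to linear hull
   raises the dimension by exactly one. *)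
Lemma has_dim_hyperplane A c k : (exists a, A a) ->
  (forall x, A x -> dotv c x = 1) ->
  has_dim A k <-> \dim (lspan A) = k.+1.
Proof.
move=> [a Aa] Ac; rewrite (has_dimE k Aa); set L := lspan [set _ | _ in _].
have cL v : v \in L -> dotv c v = 0.
  rewrite /L; have [X XA ->] := lspanE [set y - a | y in A].
  move=> /(@coord_span _ _ _ (in_tuple X)) ->; rewrite dotv_sumr big1 // => i _.
  have [y Ay <-] := XA _ (mem_nth 0 (ltn_ord i)).
  by rewrite dotvZr dotvBr !Ac // subrr mulr0.
have -> : lspan A = (<[a]> + L)%VS.
  apply/eqP; rewrite eqEsubv; apply/andP; split.
    apply: lspan_min => x Ax; rewrite -(subrK a x) addrC memv_add ?memv_line //.
    by apply: mem_lspan; exists x.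
  rewrite subv_add -memvE mem_lspan //=; apply: lspan_min => _ [y Ay <-].
  by rewrite memvB ?mem_lspan.
have a0 : a != 0.
  by apply/eqP => a0; have := Ac _ Aa; rewrite a0 dotv0r => /esym/eqP; rewrite oner_eq0.
rewrite dimv_disjoint_sum.
  by rewrite dim_vline a0 add1n; split=> [->|[]].
apply/eqP; rewrite -subv0; apply/subvP => v; rewrite memv_cap memv0.
move=> /andP[/vlineP[t ->] /cL]; rewrite dotvZr Ac // mulr1 => ->.
by rewrite scale0r.
Qed.

End Dimension.

(** * Faces *)

Lemma seq_argmax (R : realType) (T : eqType) (s : seq T) (f : T -> R) :
  s != [::] -> exists2 v, v \in s & forall x, x \in s -> f x <= f v.
Proof.
elim: s => // a [|b s] IH _.
  by exists a => [|x]; rewrite inE // => /eqP ->.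
have [v vs vmax] := IH isT; have [av|va] := leP (f a) (f v).
  exists v => [|x]; first by rewrite inE vs orbT.
  by rewrite inE => /orP[/eqP ->|/vmax].
exists a => [|x]; first by rewrite mem_head.
by rewrite inE => /orP[/eqP -> //|/vmax /le_trans]; apply; apply: ltW.
Qed.

Section Faces.
Variables (R : realType) (n : nat).
Implicit Types (P A F G V : set 'rV[R]_n) (c x v : 'rV[R]_n).

Lemma is_face_self P : is_face P P.
Proof.
exists 0, 0; split => [x _|]; first by rewrite dotv0l.
by apply/seteqP; split => [x Px|x []//]; split => //=; rewrite dotv0l.
Qed.

Lemma is_face_sub P F : is_face P F -> F `<=` P.
Proof. by move=> [c [b [_ ->]]] x []. Qed.

Lemma is_polytope_convex P : is_polytope P -> is_convex P.
Proof. by move=> [V [_ ->]]; apply: convex_hull_convex. Qed.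

Lemma face_convex_hull V F : is_face (convex_hull V) F ->
  exists c b, (forall x, V x -> dotv c x <= b) /\
    F = convex_hull (V `&` [set x | dotv c x = b]).
Proof.
move=> [c [b [Vb ->]]]; exists c, b.
have Vb' x : V x -> dotv c x <= b by move=> Vx; apply/Vb/sub_convex_hull.
by split => //; rewrite convex_hull_face.
Qed.

Lemma face_polytope P F : is_polytope P -> is_face P F -> is_polytope F.
Proof.
move=> [V [fV ->]] /face_convex_hull[c [b [_ ->]]].
by exists (V `&` [set x | dotv c x = b]); split => //; apply: finite_setIl.
Qed.

(** A face is the hull of the generators lying on it, so there are at most as many faces as subsets
    of the finite set [A] of generators. *)
Lemma finite_faces P : is_polytope P -> finite_set [set F | is_face P F].
Proof.
move=> [_ [/finite_fsetP[A ->] ->]].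
apply: (@sub_finite_set _ _
  [set convex_hull [set` B] | B in [set` fpowerset A]]).
  move=> F /= /face_convex_hull[c [b [_ ->]]].
  exists [fset x in A | dotv c x == b]%fset.
    by rewrite /= fpowersetE; apply/fsubsetP => x; rewrite !inE => /andP[].
  congr convex_hull; apply/seteqP; split => x /=.
    by rewrite !inE => /andP[? /eqP].
  by case=> xA xb; rewrite !inE /=; apply/andP; split => //; apply/eqP.
exact/finite_image/finite_fset.
Qed.

(* If F is cut out by c <= b and G is cut out of F by c' <= b', then G is cut
   out of P by M c + c' <= M b + b' for M large, as P has finitely many vertices
   outside F. *)
Lemma face_trans P F G :
  is_polytope P -> is_face P F -> is_face F G -> is_face P G.
Proof.
move=> [V [/finite_seqP[s ->] ->]] /face_convex_hull[c [b [Vb FE]]].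
move=> [c' [b' [Fb' GE]]].
have [M M0 Ms] : exists2 M, 0 <= M &
    forall x, x \in s -> (dotv c' x - b') / (b - dotv c x) <= M.
  have [->|sN] := eqVneq s [::]; first by exists 0.
  (* For points on the hyperplane the denominator is 0 and the quotient is 0 by convention; the
     bound is applied only to points off it. Using [M + 1] below makes the inequality strict
     there. *)
  have [v _ vmax] := seq_argmax
    (fun x => (dotv c' x - b') / (b - dotv c x)) sN.
  exists (Num.max 0 ((dotv c' v - b') / (b - dotv c v))).
    by rewrite le_max lexx.
  by move=> x /vmax xv; rewrite le_max xv orbT.
pose d := (M + 1) *: c + c'; pose e := (M + 1) * b + b'.
have dE x : dotv d x = (M + 1) * dotv c x + dotv c' x.
  by rewrite /d dotvDl dotvZl.
have Fs x : x \in s -> dotv c x = b -> dotv c' x <= b'.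
  by move=> xs xb; apply: Fb'; rewrite FE; apply: sub_convex_hull.
have strict x : x \in s -> dotv c x != b -> dotv d x < e.
  move=> xs xNb; have lt : 0 < b - dotv c x.
    by rewrite subr_gt0 lt_neqAle xNb Vb.
  by have := Ms _ xs; rewrite ler_pdivrMr // dE /e; nra.
have de x : x \in s -> dotv d x <= e.
  move=> xs; have [xb|xNb] := eqVneq (dotv c x) b; last exact/ltW/strict.
  by rewrite dE /e xb lerD2l Fs.
exists d, e; split.
  by apply: (convex_hull_min (@is_convex_halfspace _ _ d e)).
rewrite GE convex_hull_face // FE convex_hull_face; last first.
  by move=> x [/= xs xb]; apply: Fs.
congr convex_hull; apply/seteqP; split => x.
  by move=> [[/= xs xb] xb']; split => //=; rewrite dE xb xb'.
move=> [/= xs xe].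
have xb : dotv c x = b.
  by apply/eqP/contraT => /(strict _ xs); rewrite xe ltxx.
by split => //=; move: xe; rewrite dE xb /e; apply: addrI.
Qed.

Lemma polytope_max_face P c : is_polytope P -> (exists x, P x) ->
  exists b, (exists x, P x /\ dotv c x = b) /\ forall x, P x -> dotv c x <= b.
Proof.
move=> [V [/finite_seqP[s ->] ->]] [x0 Px0].
have sN : s != [::].
  by apply/eqP => s0; have [y] := convex_hull_nonempty Px0; rewrite /= s0.
have [v vs vmax] := seq_argmax (dotv c) sN; exists (dotv c v); split.
  by exists v; split => //; apply: sub_convex_hull.
by apply: (convex_hull_min (@is_convex_halfspace _ _ _ _)).
Qed.

(* A point of a finite set farthest from the origin is exposed by itself. *)
Lemma polytope_vertex P : is_polytope P -> (exists x, P x) ->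
  exists v, is_face P [set v].
Proof.
move=> [V [/finite_seqP[s ->] ->]] [x0 Px0].
have sN : s != [::].
  by apply/eqP => s0; have [y] := convex_hull_nonempty Px0; rewrite /= s0.
have [v vs vmax] := seq_argmax (fun x => dotv x x) sN.
have sq x : dotv (x - v) (x - v) = dotv x x - 2 * dotv v x + dotv v v.
  by rewrite dotvBr !(dotvC (x - v)) !dotvBr (dotvC x v); ring.
have le x : x \in s -> dotv v x <= dotv v v.
  by move=> xs; have := dotv_ge0 (x - v); have := vmax _ xs; rewrite sq; lra.
exists v, v, (dotv v v); split.
  by apply: (convex_hull_min (@is_convex_halfspace _ _ _ _)).
rewrite convex_hull_face // -[LHS]convex_hull_id; last exact: is_convex_set1.
congr convex_hull; apply/seteqP; split => x /= => [->//|[xs xv]].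
apply/eqP; rewrite -subr_eq0; apply/eqP/dotv_eq0.
by apply/eqP; rewrite eq_le dotv_ge0 sq xv andbT; have := vmax _ xs; lra.
Qed.

(** The points of [F] maximising [c] form a nonempty face of [F]; any vertex of that face is a
    vertex of [P] by transitivity. *)
Lemma face_max_vertex P F c : is_polytope P -> is_face P F ->
  (exists x, F x) -> exists v, [/\ F v, is_face P [set v] &
    forall x, F x -> dotv c x <= dotv c v].
Proof.
move=> pP fF F0; have pF := face_polytope pP fF.
have [b [[x [Fx xb]] Fb]] := polytope_max_face c pF F0.
have fG : is_face F (F `&` [set x | dotv c x = b]) by exists c, b.
have [|v fv] := polytope_vertex (face_polytope pF fG); first by exists x.
have [Fv vb] : (F `&` [set x | dotv c x = b]) v by apply: (is_face_sub fv).
exists v; split => //; last by rewrite vb.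
exact: face_trans pP fF (face_trans pF fG fv).
Qed.

(* Otherwise some functional is constant on the vertices of F but not on F. *)
Lemma face_vertex_count P F k (X : seq 'rV[R]_n) :
  is_polytope P -> is_face P F -> has_dim F k ->
  (forall v, F v -> is_face P [set v] -> v \in X) -> (k < size X)%N.
Proof.
move=> pP fF dF vX; have F0 := has_dim_nonempty dF.
have [p [Fp fp _]] := face_max_vertex 0 pP fF F0.
have pX : p \in X by apply: vX.
rewrite ltnNge; apply/negP => Xk.
(* One candidate serves as base point, so at most [size X - 1 < k] differences remain and [U] cannot
   contain all directions of [F]. *)
pose U := <<[seq y - p | y <- rem p X]>>%VS.
have dU : (\dim U < k)%N.
  apply: leq_ltn_trans (dim_span _) _.
  rewrite size_map size_rem //; apply: leq_trans Xk.
  by rewrite prednK //; case: (X) pX.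
have [x [Fx xU]] : exists x, F x /\ x - p \notin U.
  apply: contrapT => FU; move: dU; rewrite -((has_dimE k Fp).1 dF) ltnNge.
  move=> /negP; apply; apply/dimvS/lspan_min => _ [y Fy <-].
  by apply: contraT => yU; case: FU; exists y.
have [c [cU cx]] := functional_separating xU.
have cv v : F v -> is_face P [set v] -> dotv c v = dotv c p.
  move=> Fv fv; have [->//|vp] := eqVneq v p.
  apply/eqP; rewrite -subr_eq0 -dotvBr; apply/eqP/cU/memv_span/map_f.
  have := vX v Fv fv; rewrite (perm_mem (perm_to_rem pX)) inE (negbTE vp).
  exact.
have [v1 [Fv1 fv1 m1]] := face_max_vertex c pP fF F0.
have [v2 [Fv2 fv2 m2]] := face_max_vertex (- c) pP fF F0.
have := m1 x Fx; have := m2 x Fx; rewrite !dotvNl (cv v1) // (cv v2) // => l2 l1.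
move: cx; rewrite dotvBr; apply/negP; rewrite negbK subr_eq0.
by rewrite eq_le l1 -lerN2.
Qed.

(** Membership in the polar body of [A]. Fixing the right-hand side to 1 allows functionals of two
    summands to be juxtaposed into one for their direct sum. *)
Definition polar A c := forall x, A x -> dotv c x <= 1.

Definition cap A c := A `&` [set x | dotv c x = 1].

Lemma cap_face A c : polar A c -> is_face A (cap A c).
Proof. by move=> pc; exists c, 1. Qed.

Lemma has_dim_cap A c k : (exists x, cap A c x) ->
  has_dim (cap A c) k <-> \dim (lspan (cap A c)) = k.+1.
Proof. by move=> h; apply: (@has_dim_hyperplane _ _ _ c) => // x []. Qed.

(** By symmetry the bound [b] is nonnegative. If [b = 0], then [c] vanishes on [A] and [F] is all of
    [A]; otherwise dividing by [b] normalises the bound to 1. *)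
Lemma symmetric_face_cap A F : (forall x, A x -> A (- x)) -> is_face A F ->
  (exists x, F x) -> F <> A -> exists2 c, polar A c & F = cap A c.
Proof.
move=> sA [c [b [Ab FE]]] [x Fx] FA.
have [Ax xb] : A x /\ dotv c x = b by move: Fx; rewrite FE.
have b0 : 0 <= b by have := Ab _ (sA _ Ax); rewrite dotvNr xb; lra.
move: b0; rewrite le_eqVlt => /orP[/eqP b0|b0].
  exfalso; apply: FA; rewrite FE; apply/seteqP; split => [y []//|y Ay].
  split => //=; have := Ab _ Ay; have := Ab _ (sA _ Ay).
  by rewrite dotvNr -b0; lra.
exists (b^-1 *: c) => [y Ay|].
  by rewrite dotvZl ler_pdivrMl // mulr1 Ab.
rewrite FE; apply/seteqP; split => y [Ay /= yb]; split => //=.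
  by rewrite dotvZl yb mulVf // gt_eqF.
move: yb; rewrite dotvZl => /(congr1 ( *%R b)).
by rewrite mulrA divff ?gt_eqF // mul1r mulr1.
Qed.

End Faces.

(** * Flag numbers *)

Section FlagNumbers.
Variables (R : realType) (n : nat).
Implicit Types (P F G : set 'rV[R]_n).

Definition kfaces P k : set (set 'rV[R]_n) :=
  [set F | [/\ is_face P F, has_dim F k & F `<` P]].

Definition kflags P k l : set (set 'rV[R]_n * set 'rV[R]_n) :=
  [set p | [/\ kfaces P k p.1, kfaces P l p.2 & p.1 `<` p.2]].

Lemma proper_face P F k d : is_face P F ->
  has_dim F k -> has_dim P d -> k <> d -> kfaces P k F.
Proof.
move=> fF dF dP kd; split => //; split; first exact: is_face_sub.
move=> PF; apply: kd; apply: has_dim_unique dF _.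
by rewrite (_ : F = P) //; apply/seteqP; split => //; apply: is_face_sub.
Qed.

Lemma finite_kfaces P k : is_polytope P -> finite_set (kfaces P k).
Proof. by move=> /finite_faces; apply: sub_finite_set => F []. Qed.

Lemma finite_kflags P k l : is_polytope P -> finite_set (kflags P k l).
Proof.
move=> pP; apply: (@sub_finite_set _ _ (kfaces P k `*` kfaces P l)).
  by move=> p [].
by apply: finite_setX; apply: finite_kfaces.
Qed.

(** The length [#|S|] of a flag equals 1 or 2 only propositionally, so the tuples in the next lemmas
    are transported along that equation. *)
Lemma tcast_inj (T : Type) (m k : nat) (e : m = k) :
  injective (fun t : m.-tuple T => tcast e t).
Proof. by case: k / e. Qed.

Lemma flag_number1 d (i : 'I_d) P : is_polytope P ->
  flag_number [set i] P = #|` fset_set (kfaces P i)|.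
Proof.
move=> pP; have e : 1%N = #|[set i]%SET| by rewrite cards1.
have val0 (j : 'I_#|[set i]%SET|) : val j = 0%N.
  have : (val j < 1)%N by rewrite [X in (_ < X)%N]e ltn_ord.
  by case: (val j).
rewrite /flag_number.
have -> : flags [set i]%SET P = (fun F => tcast e [tuple F]) @` kfaces P i.
  apply/seteqP; split => t /=.
    move=> [f _ prop]; pose j := cast_ord e ord0.
    exists (tnth t j).
      have [? dj] := f j; split => //.
      by move: dj; have := enum_valP j; rewrite inE => /eqP ->.
    apply: eq_from_tnth => j'; rewrite tcastE; have -> : j' = j.
      by apply: val_inj; rewrite !val0.
    by rewrite (_ : cast_ord _ _ = ord0) //; apply: val_inj.
  move=> [F [fF dF pF] <-]; split=> [j|j j'|j].
  - rewrite tcastE (ord1 (cast_ord _ _)); split => //.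
    by have := enum_valP j; rewrite inE => /eqP ->.
  - by have := val0 j; have := val0 j' => /= -> ->.
  - by rewrite tcastE (ord1 (cast_ord _ _)).
rewrite fset_set_image ?card_imfset //; last exact: finite_kfaces.
by move=> F G /tcast_inj /(congr1 (fun t => tnth t ord0)).
Qed.

Lemma enum_set2_ord d (i j : 'I_d) : (i < j)%N ->
  enum [set i; j]%SET = [:: i; j].
Proof.
move=> ij; pose r : rel 'I_d := relpre val ltn.
apply: (@irr_sorted_eq _ r); rewrite /r.
- by move=> x y z /=; apply: ltn_trans.
- by move=> x /=; rewrite ltnn.
- rewrite {1}/enum_mem -enumT; apply: sorted_filter.
    by move=> x y z /=; apply: ltn_trans.
  by rewrite -sorted_map val_enum_ord iota_ltn_sorted.
- by rewrite /= ij.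
- by move=> x; rewrite mem_enum !inE.
Qed.

Lemma flag_number2 d (i j : 'I_d) P : is_polytope P -> (i < j)%N ->
  flag_number [set i; j] P = #|` fset_set (kflags P i j)|.
Proof.
move=> pP ij; have e : 2%N = #|[set i; j]%SET|.
  by rewrite cards2 -val_eqE /= neq_ltn ij.
pose o0 := cast_ord e ord0; pose o1 := cast_ord e (lift ord0 ord0).
have oP k : k = o0 \/ k = o1.
  have : (val k < 2)%N by rewrite [X in (_ < X)%N]e ltn_ord.
  case E : (val k) => [|[|//]] _; [left|right]; exact: val_inj.
have v0 : enum_val o0 = i by rewrite (enum_val_nth i) enum_set2_ord.
have v1 : enum_val o1 = j by rewrite (enum_val_nth i) enum_set2_ord.
pose g (p : set 'rV[R]_n * set 'rV[R]_n) := tcast e [tuple p.1; p.2].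
have g0 p : tnth (g p) o0 = p.1.
  by rewrite tcastE (_ : cast_ord _ _ = ord0) //; apply: val_inj.
have g1 p : tnth (g p) o1 = p.2.
  by rewrite tcastE (_ : cast_ord _ _ = lift ord0 ord0) //; apply: val_inj.
rewrite /flag_number.
have -> : flags [set i; j]%SET P = g @` kflags P i j.
  apply/seteqP; split => t /=.
    move=> [f inc prop]; exists (tnth t o0, tnth t o1); last first.
      by apply: eq_from_tnth => k; case: (oP k) => ->; rewrite ?g0 ?g1.
    split => /=; last exact: inc.
      by have := f o0; rewrite v0 => -[? ?]; split.
    by have := f o1; rewrite v1 => -[? ?]; split.
  move=> [[F G] [[fF dF pF] [fG dG pG] FG] <-]; split=> [k|k l|k].
  - by case: (oP k) => ->; rewrite ?g0 ?g1 ?v0 ?v1.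
  - by case: (oP k) => ->; case: (oP l) => -> //; rewrite g0 g1.
  - by case: (oP k) => ->; rewrite ?g0 ?g1.
rewrite fset_set_image ?card_imfset //; last exact: finite_kflags.
move=> [F G] [F' G'] /tcast_inj E.
have := congr1 (fun t => tnth t ord0) E.
have := congr1 (fun t => tnth t (lift ord0 ord0)) E.
by rewrite /tnth /= => -> ->.
Qed.

Lemma card_fset_set_ge (T : choiceType) (A : set T) (s : seq T) :
  finite_set A -> uniq s -> (forall x, x \in s -> A x) ->
  (size s <= #|` fset_set A|)%N.
Proof.
move=> fA us sA; apply: uniq_leq_size => // x /sA Ax.
by rewrite in_fset_set // inE.
Qed.

Lemma card_fset_set_le (T : choiceType) (A : set T) (s : seq T) :
  finite_set A -> (forall x, A x -> x \in s) -> (#|` fset_set A| <= size s)%N.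
Proof.
move=> fA As; apply: uniq_leq_size => // x.
by rewrite in_fset_set // inE => /As.
Qed.

Definition face_kfaces P k F : set (set 'rV[R]_n) :=
  [set G | kfaces P k G /\ G `<` F].

(** Double counting: the pairs are grouped by their second component, and within a group the first
    component determines the pair. *)
Lemma card_kflags P k l : is_polytope P ->
  #|` fset_set (kflags P k l)| =
  (\sum_(F <- fset_set (kfaces P l)) #|` fset_set (face_kfaces P k F)|)%N.
Proof.
move=> pP; have fl := finite_kflags k l pP; have ff := finite_kfaces l pP.
have fv F : finite_set (face_kfaces P k F).
  by apply: sub_finite_set (finite_kfaces k pP) => G [].
set A := fset_set (kflags P k l); set B := fset_set (kfaces P l).
have inA p : p \in A -> kflags P k l p by rewrite in_fset_set // inE.
transitivity (\sum_(p <- A) \sum_(F <- B | F == p.2) 1)%N.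
  rewrite -sum1_size; apply: eq_big_seq => p /inA[_ pB _].
  rewrite -big_filter filter_pred1_uniq ?big_seq1 //.
  by rewrite in_fset_set // inE.
rewrite (exchange_big_dep predT) //=; apply: eq_big_seq => F.
rewrite in_fset_set // inE => BF; rewrite sum1_count -size_filter.
apply/eqP; rewrite eqn_leq; apply/andP; split.
  rewrite -(size_map (fun p : set 'rV[R]_n * set 'rV[R]_n => p.1)).
  apply: card_fset_set_ge => //.
    rewrite map_inj_in_uniq ?filter_uniq ?fset_uniq // => -[G F1] [G' F2].
    by rewrite !mem_filter /= => /andP[/eqP <- _] /andP[/eqP <- _] ->.
  move=> G /mapP[[G' F1]]; rewrite mem_filter /= => /andP[/eqP <- /inA[Gk _ GF]].
  by move=> ->; split.
rewrite -(size_map (fun p : set 'rV[R]_n * set 'rV[R]_n => p.1)).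
apply: card_fset_set_le => // G [Gk GF].
apply/mapP; exists (G, F) => //; rewrite mem_filter /= eqxx /=.
by rewrite in_fset_set // inE.
Qed.

End FlagNumbers.

(** * Functionals that are nonnegative on all polytopes *)

Section Functionals.
Variable R : realType.

Lemma flag_functional_delta d (T : {set 'I_d}) n (P : set 'rV[R]_n) :
  flag_functional (fun S => (S == T)%:R) P = (flag_number T P)%:R.
Proof.
rewrite /flag_functional (bigD1 T) //= eqxx mul1r big1 ?addr0 // => S /negbTE ->.
by rewrite mul0r.
Qed.

(** For [0 < k], its value on a polytope totals, over all proper [k]-faces, the number of vertices
    beyond the [k + 1] of a simplex. *)
Definition simplex_excess d (k : 'I_d.+1) (S : {set 'I_d.+1}) : R :=
  (S == [set ord0; k]%SET)%:R - k.+1%:R * (S == [set k]%SET)%:R.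

Section Excess.
Variables (d n : nat) (k : 'I_d.+1) (P : set 'rV[R]_n).
Hypotheses (k_gt0 : (0 < k)%N) (pP : is_polytope P).

Let vertices F := fset_set (face_kfaces P 0 F).

Lemma finite_face_kfaces j F : finite_set (face_kfaces P j F).
Proof. by apply: sub_finite_set (finite_kfaces j pP) => G []. Qed.

Lemma simplex_excessE : flag_functional (simplex_excess k) P =
  \sum_(F <- fset_set (kfaces P k)) (#|` vertices F|%:R - k.+1%:R).
Proof.
have -> : flag_functional (simplex_excess k) P =
    (flag_number [set ord0; k]%SET P)%:R -
    k.+1%:R * (flag_number [set k]%SET P)%:R.
  rewrite -!flag_functional_delta /flag_functional mulr_sumr -sumrB.
  by apply: eq_bigr => S _; rewrite mulrBl mulrA.
rewrite flag_number2 // flag_number1 // card_kflags // natr_sum sumrB.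
by rewrite big_const_seq count_predT iter_addr_0 mulr_natr.
Qed.

(** Since [0 < k], a vertex inside [F] is a proper subset of [F], so passing between 0-faces and
    points loses nothing. *)
Lemma face_vertexP F : kfaces P k F -> forall G,
  face_kfaces P 0 F G <-> exists v, [/\ G = [set v], F v & is_face P [set v]].
Proof.
move=> [fF dF [FP _]] G; split.
  move=> [[fG dG _] [GF _]]; have [v Gv] := has_dim0_set1 dG; exists v.
  by split => //; [apply: GF; rewrite Gv | rewrite -Gv].
move=> [v [-> Fv fv]].
have vF : [set v] `<` F.
  split=> [x /= -> //|Fsub]; have E : F = [set v].
    by apply/seteqP; split => // x /= ->.
  by move: k_gt0; rewrite (has_dim_unique dF (l := 0)) // E; apply: has_dim_set1.
split => //; split => //; first exact: has_dim_set1.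
case: vF => vF Fv'; split => [x /vF /FP //|Pv]; apply: Fv' => x /FP.
exact: Pv.
Qed.

Lemma face_vertices_ge F : kfaces P k F -> (k < #|` vertices F|)%N.
Proof.
move=> kF; have [fF dF _] := kF.
(* [xget] turns each singleton face back into its point, as [face_vertex_count] speaks of points. *)
rewrite -(size_map (xget (0 : 'rV[R]_n))).
apply: (face_vertex_count pP fF dF) => v Fv fv; apply/mapP; exists [set v].
  rewrite in_fset_set ?inE; last exact: finite_face_kfaces.
  by apply/(face_vertexP kF); exists v.
by case: xgetP => [_ _ /= ->//|/(_ v) /=]; case.
Qed.

Let excess F := #|` vertices F|%:R - k.+1%:R : R.

Let excess_ge0 F : kfaces P k F -> 0 <= excess F.
Proof. by move=> kF; rewrite subr_ge0 ler_nat face_vertices_ge. Qed.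

Let in_kfaces F : F \in fset_set (kfaces P k) -> kfaces P k F.
Proof. by rewrite in_fset_set ?inE //; apply: finite_kfaces. Qed.

Lemma simplex_excess_ge0 : 0 <= flag_functional (simplex_excess k) P.
Proof.
rewrite simplex_excessE big_seq; apply: sumr_ge0 => F /in_kfaces.
exact: excess_ge0.
Qed.

Lemma simplex_excess_le0 :
  (forall F, kfaces P k F -> exists X : seq 'rV[R]_n, (size X <= k.+1)%N /\
    forall v, F v -> is_face P [set v] -> v \in X) ->
  flag_functional (simplex_excess k) P <= 0.
Proof.
move=> h; rewrite simplex_excessE big_seq; apply: sumr_le0 => F /in_kfaces kF.
rewrite subr_le0 ler_nat; have [X [sX vX]] := h F kF; apply: leq_trans sX.
rewrite -(size_map (@set1 _) X).
apply: card_fset_set_le; first exact: finite_face_kfaces.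
move=> G /(face_vertexP kF)[v [-> Fv fv]].
by apply/mapP; exists v => //; apply: vX.
Qed.

Lemma simplex_excess_gt0 F (s : seq 'rV[R]_n) : kfaces P k F ->
  uniq s -> (k.+1 < size s)%N ->
  (forall v, v \in s -> F v /\ is_face P [set v]) ->
  0 < flag_functional (simplex_excess k) P.
Proof.
move=> kF us ks sF; rewrite simplex_excessE (bigD1_seq F) /=; last exact: fset_uniq.
  apply: ltr_pwDl; last first.
    rewrite big_seq_cond; apply: sumr_ge0 => G /andP[/in_kfaces kG _].
    exact: excess_ge0.
  rewrite subr_gt0 ltr_nat; apply: leq_trans ks _.
  rewrite -(size_map (@set1 _) s); apply: card_fset_set_ge.
  - exact: finite_face_kfaces.
  - rewrite map_inj_uniq // => x y /(congr1 (fun A : set _ => A x)) /= E.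
    by rewrite -E.
  - move=> G /mapP[v /sF[Fv fv] ->]; apply/(face_vertexP kF); by exists v.
by rewrite in_fset_set ?inE //; apply: finite_kfaces.
Qed.

End Excess.

Lemma simplex_excess_nonneg d (k : 'I_d.+1) : (0 < k)%N ->
  nonneg_functionals d.+1 (simplex_excess k).
Proof. by move=> k0 n P [pP _]; apply: simplex_excess_ge0. Qed.

Lemma flag_number_nonneg d (T : {set 'I_d}) :
  nonneg_functionals d (fun S => (S == T)%:R : R).
Proof. by move=> n P _; rewrite flag_functional_delta ler0n. Qed.

End Functionals.

(** * Products and direct sums *)

Section ProductsAndSums.
Variables (R : realType) (m n : nat).
Implicit Types (A F : set 'rV[R]_m) (B G : set 'rV[R]_n).

Let axisl A : set 'rV[R]_(m + n) := [set row_mx x 0 | x in A].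
Let axisr B : set 'rV[R]_(m + n) := [set row_mx 0 y | y in B].

Lemma row_mx_conv (x x' : 'rV[R]_m) (y y' : 'rV[R]_n) (t : R) :
  row_mx (t *: x + (1 - t) *: x') (t *: y + (1 - t) *: y') =
  t *: row_mx x y + (1 - t) *: row_mx x' y'.
Proof. by rewrite !scale_row_mx add_row_mx. Qed.

Lemma direct_product_polytope A B :
  is_polytope A -> is_polytope B -> is_polytope (direct_product A B).
Proof.
move=> [V [fV ->]] [W [fW ->]]; exists (direct_product V W); split.
  exact: finite_image2.
apply/seteqP; split => z.
  move=> [x Vx [y Wy <-]].
  (* One coordinate is treated at a time: with the other one fixed the embedding is affine, so the
     preimage of a hull is convex and need only contain the generators. *)
  have step v : V v -> convex_hull (direct_product V W) (row_mx v y).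
    move=> Vv; move: y Wy; apply: convex_hull_min => [|y Wy]; last first.
      by apply: sub_convex_hull; exists v => //; exists y.
    apply: (@is_convex_preimage _ _ _ (row_mx v)); last exact: convex_hull_convex.
    move=> y y' t; rewrite -row_mx_conv; congr row_mx.
    by rewrite -scalerDl addrC subrK scale1r.
  move: x Vx; apply: convex_hull_min => // .
  apply: (@is_convex_preimage _ _ _ (fun x => row_mx x y));
    last exact: convex_hull_convex.
  move=> x x' t; rewrite -row_mx_conv; congr row_mx.
  by rewrite -scalerDl addrC subrK scale1r.
apply: convex_hull_min => [|_ [x Vx [y Wy <-]]]; last first.
  by exists x; [apply: sub_convex_hull|exists y => //; apply: sub_convex_hull].
move=> _ _ t [x Vx [y Wy <-]] [x' Vx' [y' Wy' <-]] t01; rewrite -row_mx_conv.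
exists (t *: x + (1 - t) *: x'); first exact: convex_hull_convex.
by exists (t *: y + (1 - t) *: y') => //; apply: convex_hull_convex.
Qed.

Lemma direct_sum_polytope A B :
  is_polytope A -> is_polytope B -> is_polytope (direct_sum A B).
Proof.
move=> [V [fV ->]] [W [fW ->]]; exists (axisl V `|` axisr W); split.
  by rewrite finite_setU; split; apply: finite_image.
apply/seteqP; split; last first.
  apply: convex_hull_mono => _ [[x Vx <-]|[y Wy <-]];
    by [left; exists x => //; apply: sub_convex_hull
       |right; exists y => //; apply: sub_convex_hull].
apply: convex_hull_min; first exact: convex_hull_convex.
move=> _ [[x Vx <-]|[y Wy <-]].
  move: x Vx; apply: convex_hull_min => [|x Vx]; last first.
    by apply: sub_convex_hull; left; exists x.
  apply: (@is_convex_preimage _ _ _ (fun x => row_mx x 0));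
    last exact: convex_hull_convex.
  by move=> x x' t; rewrite -row_mx_conv !scaler0 addr0.
move: y Wy; apply: convex_hull_min => [|y Wy]; last first.
  by apply: sub_convex_hull; right; exists y.
apply: (@is_convex_preimage _ _ _ (row_mx 0)); last exact: convex_hull_convex.
by move=> y y' t; rewrite -row_mx_conv !scaler0 addr0.
Qed.

(** The two functionals are juxtaposed and the bounds added; equality in the sum forces equality in
    both summands. *)
Lemma direct_product_face A B F G :
  is_face A F -> is_face B G ->
  is_face (direct_product A B) (direct_product F G).
Proof.
move=> [c [b [Ab ->]]] [c' [b' [Bb' ->]]]; exists (row_mx c c'), (b + b').
split.
  by move=> _ [x Ax [y By <-]]; rewrite dotv_row_mx lerD ?Ab ?Bb'.
apply/seteqP; split => z.
  move=> [x [Ax /= xb] [y [By /= yb] <-]]; split; first by exists x => //; exists y.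
  by rewrite /= dotv_row_mx xb yb.
move=> [[x Ax [y By <-]] /=]; rewrite dotv_row_mx => E.
have := Ab _ Ax; have := Bb' _ By => h h'.
by exists x; [split=> //=; lra|exists y => //; split => //=; lra].
Qed.

Lemma lspan_direct_product A B : A 0 -> B 0 ->
  lspan (direct_product A B) = lspan (axisl A `|` axisr B).
Proof.
move=> A0 B0; apply/eqP; rewrite eqEsubv; apply/andP; split; last first.
  apply: lspan_mono => _ [[x Ax <-]|[y By <-]]; first by exists x => //; exists 0.
  by exists 0 => //; exists y.
apply: lspan_min => _ [x Ax [y By <-]].
have -> : row_mx x y = row_mx x 0 + row_mx 0 y by rewrite add_row_mx addr0 add0r.
by rewrite memvD // mem_lspan //; [left; exists x|right; exists y].
Qed.

(** After translating both factors to contain the origin, the product spans the same space as the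
    union of its two axis copies. *)
Lemma direct_product_dim A B k l : has_dim A k -> has_dim B l ->
  has_dim (direct_product A B) (k + l).
Proof.
move=> dA dB; have [a Aa] := has_dim_nonempty dA.
have [b Bb] := has_dim_nonempty dB.
apply/(@has_dimE _ _ _ (row_mx a b)); first by exists a => //; exists b.
rewrite -((has_dimE k Aa).1 dA) -((has_dimE l Bb).1 dB).
have -> : [set z - row_mx a b | z in direct_product A B] =
    direct_product [set x - a | x in A] [set y - b | y in B].
  apply/seteqP; split => z.
    move=> [_ [x Ax [y By <-]] <-]; rewrite opp_row_mx add_row_mx.
    by exists (x - a); [exists x|exists (y - b) => //; exists y].
  move=> [_ [x Ax <-] [_ [y By <-] <-]].
  exists (row_mx x y); first by exists x => //; exists y.
  by rewrite opp_row_mx add_row_mx.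
rewrite lspan_direct_product; [exact: dim_lspan_sum| |].
  by exists a => //; rewrite subrr.
by exists b => //; rewrite subrr.
Qed.

Lemma polar_direct_sum A B c d :
  polar A c -> polar B d -> polar (direct_sum A B) (row_mx c d).
Proof.
move=> pc pd; apply: (convex_hull_min (@is_convex_halfspace _ _ _ _)).
move=> _ [[x Ax <-]|[y By <-]] /=; rewrite dotv_row_mx dotv0r ?addr0 ?add0r.
  exact: pc.
exact: pd.
Qed.

(** The generators of the direct sum lie on the two axes, where [row_mx c d] acts as [c] or as [d];
    the face is thus the join of the two caps. *)
Lemma cap_direct_sum A B c d : polar A c -> polar B d ->
  cap (direct_sum A B) (row_mx c d) =
  convex_hull (axisl (cap A c) `|` axisr (cap B d)).
Proof.
move=> pc pd; rewrite /cap /direct_sum convex_hull_face; last first.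
  move=> _ [[x Ax <-]|[y By <-]] /=; rewrite dotv_row_mx dotv0r ?addr0 ?add0r.
    exact: pc.
  exact: pd.
congr convex_hull; apply/seteqP; split => z.
  move=> [[[x Ax <-]|[y By <-]] /=]; rewrite dotv_row_mx dotv0r ?addr0 ?add0r => E.
    by left; exists x.
  by right; exists y.
move=> [[x [Ax /= xc] <-]|[y [By /= yd] <-]]; split.
- by left; exists x.
- by rewrite /= dotv_row_mx dotv0r addr0.
- by right; exists y.
- by rewrite /= dotv_row_mx dotv0r add0r.
Qed.

Lemma cap_direct_suml A B c d x : A x ->
  cap (direct_sum A B) (row_mx c d) (row_mx x 0) <-> cap A c x.
Proof.
move=> Ax; rewrite /cap /= dotv_row_mx dotv0r addr0; split=> [[_ ?]|[_ ?]]; split => //.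
by apply: sub_convex_hull; left; exists x.
Qed.

Lemma cap_direct_sumr A B c d y : B y ->
  cap (direct_sum A B) (row_mx c d) (row_mx 0 y) <-> cap B d y.
Proof.
move=> By; rewrite /cap /= dotv_row_mx dotv0r add0r; split=> [[_ ?]|[_ ?]]; split => //.
by apply: sub_convex_hull; right; exists y.
Qed.

(** Linear dimensions add, so nonempty caps of affine dimensions k and l yield a cap of affine
    dimension k + l + 1. *)
Lemma dim_cap_direct_sum A B c d : polar A c -> polar B d ->
  \dim (lspan (cap (direct_sum A B) (row_mx c d))) =
  (\dim (lspan (cap A c)) + \dim (lspan (cap B d)))%N.
Proof.
by move=> pc pd; rewrite cap_direct_sum // lspan_convex_hull dim_lspan_sum.
Qed.

(** The functional 0 has an empty cap; pairing it with [c] makes a proper face of one summand a face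
    of the direct sum. *)
Lemma polar0 B : polar B 0.
Proof. by move=> y _; rewrite dotv0l. Qed.

Lemma cap0 B : cap B 0 = set0.
Proof.
by apply/seteqP; split => // y [_ /=]; rewrite dotv0l => /esym/eqP; rewrite oner_eq0.
Qed.

End ProductsAndSums.

(** * Hanner polytopes *)

Section Hanner.
Variable R : realType.

(** [s] need not list all vertices of [F]: this is a certificate that the 2-face is not a
    triangle. *)
Definition has_quad n (P : set 'rV[R]_n) := exists F (s : seq 'rV[R]_n),
  [/\ is_face P F, has_dim F 2, uniq s, size s = 4%N
    & forall v, v \in s -> F v /\ is_face P [set v]].

(** An arbitrary finite index type lets the facets of products and direct sums be indexed by sum and
    product types. *)
Definition facets_ge n (P : set 'rV[R]_n) (d m : nat) :=
  exists (T : finType) (c : T -> 'rV[R]_n),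
  [/\ forall t, polar P (c t), forall t, has_dim (cap P (c t)) d.-1,
      injective (fun t => cap P (c t)) & (m <= #|T|)%N].

(** The invariant of the induction on Hanner polytopes. The bound [2 < d] makes the quadrilateral a
    proper face, which direct sums preserve; a planar parallelogram falls under the second
    alternative with its four edges. [hi_edge] supplies the factors of a parallelogram in a
    product. *)
Record hanner_inv n (H : set 'rV[R]_n) (d : nat) : Prop := HannerInv {
  hi_polytope : is_polytope H;
  hi_sym : forall x, H x -> H (- x);
  hi_zero : H 0;
  hi_dim : has_dim H d;
  hi_pos : (0 < d)%N;
  hi_edge : exists F, is_face H F /\ has_dim F 1;
  hi_quad : (2 < d)%N /\ has_quad H \/ facets_ge H d (2 ^ d) }.

Lemma edge_vertices n (P F : set 'rV[R]_n) : is_polytope P -> is_face P F ->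
  has_dim F 1 -> exists p q, [/\ p != q, F p /\ F q, is_face P [set p]
                               & is_face P [set q]].
Proof.
move=> pP fF dF.
have [p [Fp fp _]] := face_max_vertex 0 pP fF (has_dim_nonempty dF).
(* Were [p] the only vertex of the edge, the vertex count would give [1 < 1]. *)
apply: contrapT => h; suff : (1 < size [:: p])%N by [].
apply: face_vertex_count pP fF dF _ => v Fv fv; rewrite inE.
by apply: contraT => vp; case: h; exists p, v; rewrite eq_sym.
Qed.

Lemma hanner_inv_vertex n (H : set 'rV[R]_n) d : hanner_inv H d ->
  exists v c, polar H c /\ cap H c = [set v].
Proof.
move=> hH; have [v fv] := polytope_vertex (hi_polytope hH) (ex_intro _ 0 (hi_zero hH)).
have [||c pc cE] := symmetric_face_cap (hi_sym hH) fv; first by exists v.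
  move=> E; have := hi_pos hH; have := hi_dim hH; rewrite -E => dv.
  by rewrite (has_dim_unique dv (has_dim_set1 v)).
by exists v, c.
Qed.

Lemma hanner_inv_segment n (P : set 'rV[R]_n) :
  is_dpolytope 1 P -> centrally_symmetric P -> hanner_inv P 1.
Proof.
move=> [pP dP] sP.
have sP' x : P x -> P (- x) by move=> Px; rewrite sP; exists x.
have [x Px] := has_dim_nonempty dP.
have P0 : P 0.
  have := is_polytope_convex pP Px (sP' _ Px) (t := 2^-1); rewrite scalerN.
  rewrite (_ : 1 - 2^-1 = 2^-1 :> R) ?subrr; last by field.
  by apply; apply/andP; split; lra.
have [v fv] := polytope_vertex pP (ex_intro _ _ Px).
have [||c pc cE] := symmetric_face_cap sP' fv; first by exists v.
  by move=> E; have := has_dim_unique dP; rewrite -E => /(_ _ (has_dim_set1 v)).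
have cv : dotv c v = 1 by have [] : cap P c v by rewrite -cE.
have cN : cap P (- c) = [set - v].
  apply/seteqP; split => y.
    move=> [Py /= yc]; have : cap P c (- y).
      by split; [apply: sP'|rewrite /= dotvNr -dotvNl].
    by rewrite -cE => /= <-; rewrite opprK.
  move=> /= ->; split; last by rewrite /= dotvNl dotvNr opprK.
  by apply: sP'; apply: (is_face_sub fv).
split => //; first by exists P; split => //; apply: is_face_self.
(* The facets of the segment are its endpoints [v] and [- v], cut out by [c] and [- c]. *)
right; exists bool, (fun b : bool => if b then c else - c); split.
- case=> [//|y Py]; rewrite dotvNl -dotvNr; apply: pc; exact: sP'.
- by case; rewrite ?cN -?cE; apply: has_dim_set1.
- have vN : v <> - v.
    move=> E; have := cv; rewrite E dotvNr cv => /eqP.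
    by rewrite -subr_eq0 -opprD oppr_eq0 -mulr2n pnatr_eq0.
  case=> [] [] //; rewrite cN -cE => /(congr1 (fun A : set _ => A v)) /= E;
    exfalso; apply: vN.
    by rewrite -E.
  by rewrite E.
- by rewrite card_bool.
Qed.

(** * The invariant under products and direct sums *)

Section Operations.
Variables (m n a b : nat) (A : set 'rV[R]_m) (B : set 'rV[R]_n).
Hypotheses (hA : hanner_inv A a) (hB : hanner_inv B b).

Let a_gt0 := hi_pos hA.
Let b_gt0 := hi_pos hB.

Lemma set1_direct_product (p : 'rV[R]_m) (q : 'rV[R]_n) :
  direct_product [set p] [set q] = [set row_mx p q].
Proof.
apply/seteqP; split => z; first by move=> [_ /= -> [_ /= -> <-]].
by move=> /= ->; exists p => //; exists q.
Qed.

Lemma has_quad_direct_product : has_quad (direct_product A B).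
Proof.
have [F [fF dF]] := hi_edge hA; have [G [fG dG]] := hi_edge hB.
have [p [q [pq [Fp Fq] fp fq]]] := edge_vertices (hi_polytope hA) fF dF.
have [r [s [rs [Gr Gs] fr fs]]] := edge_vertices (hi_polytope hB) fG dG.
exists (direct_product F G),
  [:: row_mx p r; row_mx p s; row_mx q r; row_mx q s]; split => //.
- exact: direct_product_face.
- exact: (direct_product_dim dF dG).
- have E (x x' : 'rV[R]_m) (y y' : 'rV[R]_n) :
      (row_mx x y == row_mx x' y') = (x == x') && (y == y').
    by apply/eqP/andP => [/eq_row_mx[-> ->]|[/eqP -> /eqP ->]]; rewrite ?eqxx.
  by rewrite /= !inE !E !eqxx (negbTE pq) (negbTE rs).
- have vertex x y : F x -> is_face A [set x] -> G y -> is_face B [set y] ->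
      direct_product F G (row_mx x y) /\
      is_face (direct_product A B) [set row_mx x y].
    move=> Fx fx Gy fy; split; first by exists x => //; exists y.
    by rewrite -set1_direct_product; apply: direct_product_face.
  by move=> v; rewrite !inE => /or4P[] /eqP ->; apply: vertex.
Qed.

(** A facet of one factor times the whole other factor is a facet of the product. *)
Lemma facets_ge_direct_product k l : facets_ge A a k -> facets_ge B b l ->
  facets_ge (direct_product A B) (a + b) (k + l).
Proof.
move=> [S [c [pc dc ic kS]]] [T [d [pd dd id lT]]].
have A0 := hi_zero hA; have B0 := hi_zero hB.
have capl e : cap (direct_product A B) (row_mx e 0) = direct_product (cap A e) B.
  apply/seteqP; split => z.
    move=> [[x Ax [y By <-]] /=]; rewrite dotv_row_mx dotv0l addr0 => xe.
    by exists x => //; exists y.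
  move=> [x [Ax /= xe] [y By <-]]; split; first by exists x => //; exists y.
  by rewrite /= dotv_row_mx dotv0l addr0.
have capr e : cap (direct_product A B) (row_mx 0 e) = direct_product A (cap B e).
  apply/seteqP; split => z.
    move=> [[x Ax [y By <-]] /=]; rewrite dotv_row_mx dotv0l add0r => xe.
    by exists x => //; exists y.
  move=> [x Ax [y [By /= ye] <-]]; split; first by exists x => //; exists y.
  by rewrite /= dotv_row_mx dotv0l add0r.
(* Points with second coordinate 0 recover the facet of [A] from that of the product. *)
have inl_ s s' : cap (direct_product A B) (row_mx (c s) 0) =
    cap (direct_product A B) (row_mx (c s') 0) -> cap A (c s) `<=` cap A (c s').
  move=> E x xs; have : cap (direct_product A B) (row_mx (c s) 0) (row_mx x 0).
    by rewrite capl; exists x => //; exists 0.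
  by rewrite E => -[_ /=]; rewrite dotv_row_mx dotv0l addr0 => ?; case: xs.
have inr_ t t' : cap (direct_product A B) (row_mx 0 (d t)) =
    cap (direct_product A B) (row_mx 0 (d t')) -> cap B (d t) `<=` cap B (d t').
  move=> E y yt; have : cap (direct_product A B) (row_mx 0 (d t)) (row_mx 0 y).
    by rewrite capr; exists 0 => //; exists y.
  by rewrite E => -[_ /=]; rewrite dotv_row_mx dotv0l add0r => ?; case: yt.
(* For [x] in the facet of [A], the point [row_mx x 0] lies on the left-hand facet, while the
   functional on the right takes the value 0 there. *)
have lr s t : cap (direct_product A B) (row_mx (c s) 0) <>
              cap (direct_product A B) (row_mx 0 (d t)).
  move=> E; have [x xs] := has_dim_nonempty (dc s).
  have : cap (direct_product A B) (row_mx (c s) 0) (row_mx x 0).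
    by rewrite capl; exists x => //; exists 0.
  rewrite E => -[_ /=]; rewrite dotv_row_mx dotv0l dotv0r addr0.
  by move/esym/eqP; rewrite oner_eq0.
exists (S + T)%type,
  (fun u => match u with inl s => row_mx (c s) 0 | inr t => row_mx 0 (d t) end).
split.
- case=> [s|t] _ [x Ax [y By <-]]; rewrite dotv_row_mx dotv0l ?addr0 ?add0r.
    exact: pc.
  exact: pd.
- case=> [s|t].
    rewrite capl -(prednK a_gt0) addSn /=.
    exact: direct_product_dim (dc s) (hi_dim hB).
  rewrite capr -(prednK b_gt0) addnS /=.
  exact: direct_product_dim (hi_dim hA) (dd t).
- case=> [s|t] [s'|t'] /= E.
  + by congr inl; apply: ic; apply/seteqP; split; apply: inl_.
  + by case: (lr _ _ E).
  + by case: (lr _ _ (esym E)).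
  + by congr inr; apply: id; apply/seteqP; split; apply: inr_.
- by rewrite card_sum leq_add.
Qed.

Lemma hanner_inv_direct_product : hanner_inv (direct_product A B) (a + b).
Proof.
split.
- by apply: direct_product_polytope; apply: hi_polytope; eassumption.
- move=> _ [x Ax [y By <-]]; rewrite opp_row_mx.
  by exists (- x); [apply: (hi_sym hA)|exists (- y) => //; apply: (hi_sym hB)].
- by exists 0; [apply: (hi_zero hA)|exists 0; [apply: (hi_zero hB)|rewrite row_mx0]].
- exact: direct_product_dim (hi_dim hA) (hi_dim hB).
- by rewrite addn_gt0 a_gt0.
(* An edge of the product is an edge of [A] times a vertex of [B]. *)
- have [F [fF dF]] := hi_edge hA; have [v [c [pc cv]]] := hanner_inv_vertex hB.
  exists (direct_product F (cap B c)); split.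
    by apply: direct_product_face => //; apply: cap_face.
  by rewrite cv; apply: (direct_product_dim dF (has_dim_set1 v)).
- have [ab|ab] := ltnP 2 (a + b).
    by left; split => //; exact: has_quad_direct_product.
  (* The remaining case is a product of two segments, with 2 + 2 = 2 ^ 2 facets. *)
  right; have a1 : a = 1%N.
    apply/eqP; rewrite eqn_leq a_gt0 andbT -(leq_add2r 1).
    exact: leq_trans (leq_add (leqnn a) b_gt0) ab.
  have b1 : b = 1%N.
    apply/eqP; rewrite eqn_leq b_gt0 andbT -(leq_add2l 1).
    exact: leq_trans (leq_add a_gt0 (leqnn b)) ab.
  have fA : facets_ge A a 2 by case: (hi_quad hA) => [[]|]; rewrite a1.
  have fB : facets_ge B b 2 by case: (hi_quad hB) => [[]|]; rewrite b1.
  by have := facets_ge_direct_product fA fB; rewrite a1 b1.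
Qed.

(** The join of a facet of [A] and a facet of [B] is a facet, of linear dimension [a + b];
    restricting it to the axes recovers both, so distinct pairs give distinct facets. *)
Lemma facets_ge_direct_sum k l : facets_ge A a k -> facets_ge B b l ->
  facets_ge (direct_sum A B) (a + b) (k * l).
Proof.
move=> [S [c [pc dc ic kS]]] [T [d [pd dd id lT]]].
exists (S * T)%type, (fun u => row_mx (c u.1) (d u.2)); split.
- by move=> u; apply: polar_direct_sum.
- move=> [s t] /=; have [x xs] := has_dim_nonempty (dc s).
  apply/has_dim_cap.
    by exists (row_mx x 0); apply/cap_direct_suml => //; case: xs.
  rewrite dim_cap_direct_sum // ((has_dim_cap _ _).1 (dc s)); last by exists x.
  rewrite ((has_dim_cap _ _).1 (dd t)); last exact: has_dim_nonempty (dd t).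
  by rewrite !prednK // addn_gt0 a_gt0.
- move=> [s t] [s' t'] /= E; congr pair; [apply: ic|apply: id];
    apply/seteqP; split => x xs; have xH := xs.1.
  + by apply/(cap_direct_suml B _ (d t') xH); rewrite -E; apply/cap_direct_suml.
  + by apply/(cap_direct_suml B _ (d t) xH); rewrite E; apply/cap_direct_suml.
  + by apply/(cap_direct_sumr A (c s') _ xH); rewrite -E; apply/cap_direct_sumr.
  + by apply/(cap_direct_sumr A (c s) _ xH); rewrite E; apply/cap_direct_sumr.
- by rewrite card_prod leq_mul.
Qed.

(** As [2 < a], the 2-face and its vertices are proper faces, hence caps; extending their
    functionals by 0 carries them over to the direct sum. *)
Lemma has_quad_direct_suml :
  (2 < a)%N -> has_quad A -> has_quad (direct_sum A B).
Proof.
move=> a2 [F [s [fF dF us s4 sF]]].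
have cap_of G : is_face A G -> forall k, has_dim G k -> (k < a)%N ->
    exists2 c, polar A c & G = cap A c.
  move=> fG k dG ka; apply: (symmetric_face_cap (hi_sym hA)) => //.
    exact: has_dim_nonempty dG.
  move=> E; move: ka; rewrite E in dG.
  by rewrite (has_dim_unique dG (hi_dim hA)) ltnn.
have [c pc FE] := cap_of _ fF _ dF a2.
exists (cap (direct_sum A B) (row_mx c 0)), [seq row_mx v (0 : 'rV[R]_n) | v <- s].
have p0 := @polar0 _ _ B; split.
- by apply: cap_face; apply: polar_direct_sum.
- have [x Fx] := has_dim_nonempty dF; rewrite FE in Fx dF.
  apply/has_dim_cap.
    by exists (row_mx x 0); apply/cap_direct_suml => //; case: Fx.
  rewrite dim_cap_direct_sum // cap0 lspan_set0 dimv0 addn0.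
  by apply/has_dim_cap => //; exists x.
- by rewrite map_inj_uniq // => x y /eq_row_mx[].
- by rewrite size_map.
- move=> _ /mapP[v /sF[Fv fv] ->]; split.
    by apply/cap_direct_suml; rewrite FE in Fv => //; case: Fv.
  have [e pe vE] := cap_of _ fv _ (has_dim_set1 v) a_gt0.
  have -> : [set row_mx v 0] = cap (direct_sum A B) (row_mx e 0).
    rewrite cap_direct_sum // cap0 -vE image_set1 image_set0 setU0.
    by rewrite convex_hull_id //; apply: is_convex_set1.
  by apply: cap_face; apply: polar_direct_sum.
Qed.

Lemma has_quad_direct_sumr :
  (2 < b)%N -> has_quad B -> has_quad (direct_sum A B).
Proof.
move=> b2 [F [s [fF dF us s4 sF]]].
have cap_of G : is_face B G -> forall k, has_dim G k -> (k < b)%N ->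
    exists2 c, polar B c & G = cap B c.
  move=> fG k dG kb; apply: (symmetric_face_cap (hi_sym hB)) => //.
    exact: has_dim_nonempty dG.
  move=> E; move: kb; rewrite E in dG.
  by rewrite (has_dim_unique dG (hi_dim hB)) ltnn.
have [c pc FE] := cap_of _ fF _ dF b2.
exists (cap (direct_sum A B) (row_mx 0 c)), [seq row_mx (0 : 'rV[R]_m) v | v <- s].
have p0 := @polar0 _ _ A; split.
- by apply: cap_face; apply: polar_direct_sum.
- have [x Fx] := has_dim_nonempty dF; rewrite FE in Fx dF.
  apply/has_dim_cap.
    by exists (row_mx 0 x); apply/cap_direct_sumr => //; case: Fx.
  rewrite dim_cap_direct_sum // cap0 lspan_set0 dimv0 add0n.
  by apply/has_dim_cap => //; exists x.
- by rewrite map_inj_uniq // => x y /eq_row_mx[].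
- by rewrite size_map.
- move=> _ /mapP[v /sF[Fv fv] ->]; split.
    by apply/cap_direct_sumr; rewrite FE in Fv => //; case: Fv.
  have [e pe vE] := cap_of _ fv _ (has_dim_set1 v) b_gt0.
  have -> : [set row_mx 0 v] = cap (direct_sum A B) (row_mx 0 e).
    rewrite cap_direct_sum // cap0 -vE image_set1 image_set0 set0U.
    by rewrite convex_hull_id //; apply: is_convex_set1.
  by apply: cap_face; apply: polar_direct_sum.
Qed.

Lemma hanner_inv_direct_sum : hanner_inv (direct_sum A B) (a + b).
Proof.
have A0 := hi_zero hA; have B0 := hi_zero hB.
have S0 : direct_sum A B 0.
  by apply: sub_convex_hull; left; exists 0 => //; rewrite row_mx0.
split => //.
- by apply: direct_sum_polytope; apply: hi_polytope; eassumption.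
- move=> z; apply: (convex_hull_min (is_convex_opp (@convex_hull_convex _ _ _))).
  move=> _ [[x Ax <-]|[y By <-]]; apply: sub_convex_hull; rewrite opp_row_mx oppr0.
    by left; exists (- x) => //; apply: (hi_sym hA).
  by right; exists (- y) => //; apply: (hi_sym hB).
- apply/has_dim0E => //; rewrite lspan_convex_hull dim_lspan_sum.
  by rewrite ((has_dim0E _ A0).1 (hi_dim hA)) ((has_dim0E _ B0).1 (hi_dim hB)).
- by rewrite addn_gt0 a_gt0.
(* The join of a vertex of [A] and a vertex of [B] is an edge: the linear dimensions 1 and 1 add up
   to 2. *)
- have [v [c [pc cv]]] := hanner_inv_vertex hA.
  have [w [d [pd dw]]] := hanner_inv_vertex hB.
  have vA : cap A c v by rewrite cv.
  have wB : cap B d w by rewrite dw.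
  exists (cap (direct_sum A B) (row_mx c d)); split.
    by apply: cap_face; apply: polar_direct_sum.
  apply/has_dim_cap.
    by exists (row_mx v 0); apply/cap_direct_suml => //; case: vA.
  rewrite dim_cap_direct_sum //.
  rewrite ((has_dim_cap 0 _).1 _); [|by exists v|by rewrite cv; apply: has_dim_set1].
  by rewrite ((has_dim_cap 0 _).1 _); [|by exists w|by rewrite dw; apply: has_dim_set1].
- case: (hi_quad hA) => [[a2 qA]|fA].
    by left; split; [apply: ltn_addr|apply: has_quad_direct_suml].
  case: (hi_quad hB) => [[b2 qB]|fB].
    by left; split; [apply: ltn_addl|apply: has_quad_direct_sumr].
  by right; rewrite expnD; apply: facets_ge_direct_sum.
Qed.

End Operations.

Lemma hanner_hanner_inv n (H : set 'rV[R]_n) :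
  hanner H -> exists d, hanner_inv H d.
Proof.
elim=> {n H} [n P dP sP|m n A B _ [a hA] _ [b hB]|m n A B _ [a hA] _ [b hB]].
- by exists 1%N; apply: hanner_inv_segment.
- by exists (a + b)%N; apply: hanner_inv_direct_sum.
- by exists (a + b)%N; apply: hanner_inv_direct_product.
Qed.

End Hanner.

(** * The counterexample *)

Section Counterexample.
Variable R : realType.

Let half : 'rV[R]_4 := const_mx 2^-1.
Let evec (i : 'I_4) : 'rV[R]_4 := delta_mx 0 i.

Definition half_points : seq 'rV[R]_4 := half :: [seq evec i | i <- enum 'I_4].

Definition stacked_points := half_points ++ [seq - v | v <- half_points].

Definition stacked_cross : set 'rV[R]_4 := convex_hull [set` stacked_points].

Let P := stacked_cross.

Lemma stacked_cross_polytope : is_polytope P.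
Proof. by exists [set` stacked_points]; split => //; apply: finite_seq. Qed.

Lemma stacked_points_opp v : v \in stacked_points -> - v \in stacked_points.
Proof.
rewrite !mem_cat => /orP[vs|/mapP[w ws ->]]; last by rewrite opprK ws.
by rewrite map_f ?orbT.
Qed.

Lemma evec_point i : evec i \in stacked_points.
Proof. by rewrite mem_cat inE map_f ?mem_enum ?orbT. Qed.

Lemma half_point : half \in stacked_points.
Proof. by rewrite mem_cat mem_head. Qed.

Lemma stacked_pointsP v : v \in stacked_points ->
  exists2 w, w = half \/ exists i, w = evec i & v = w \/ v = - w.
Proof.
rewrite mem_cat => /orP[|/mapP[w + ->]]; rewrite inE => /orP[/eqP ->|/mapP[i _ ->]].
- by exists half; left.
- by exists (evec i); [right; exists i|left].
- by exists half; [left|right].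
- by exists (evec i); [right; exists i|right].
Qed.

Lemma stacked_cross_opp v : P v -> P (- v).
Proof.
apply: (convex_hull_min (is_convex_opp (@convex_hull_convex _ _ _))) => w ws.
exact/sub_convex_hull/stacked_points_opp.
Qed.

Lemma stacked_cross_symmetric : centrally_symmetric P.
Proof.
apply/seteqP; split => [v Pv|_ [v Pv <-]]; last exact: stacked_cross_opp.
by exists (- v); [apply: stacked_cross_opp|rewrite opprK].
Qed.

Lemma dim_evecs (U : {vspace 'rV[R]_4}) :
  (forall i, evec i \in U) -> \dim U = 4%N.
Proof.
move=> Uu; have -> : U = fullv.
  apply/eqP; rewrite eqEsubv subvf; apply/subvP => v _; rewrite (row_sum_delta v).
  by apply: memv_suml => i _; rewrite memvZ // Uu.
by rewrite dimvf.
Qed.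

Lemma stacked_cross_dim : has_dim P 4.
Proof.
have P0 : P 0.
  have Ph : P half by apply/sub_convex_hull/half_point.
  have := @convex_hull_convex _ _ _ _ _ (2^-1) Ph (stacked_cross_opp Ph).
  rewrite scalerN (_ : 1 - 2^-1 = 2^-1 :> R) ?subrr; last by field.
  by apply; apply/andP; split; lra.
apply/has_dim0E => //; apply: dim_evecs => i.
exact/mem_lspan/sub_convex_hull/evec_point.
Qed.

(** * Faces of the example cut out by a polar functional *)

Section Cap.
Variable c : 'rV[R]_4.
Hypothesis pc : polar P c.

Lemma dotv_half : dotv c half = (\sum_i c 0 i) / 2.
Proof. by rewrite /dotv mulr_suml; apply: eq_bigr => i _; rewrite mxE. Qed.

Lemma dotv_evec i : dotv c (evec i) = c 0 i.
Proof. by rewrite dotvC dotv_delta. Qed.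

Lemma polar_coord i : -1 <= c 0 i <= 1.
Proof.
have h v : v \in stacked_points -> dotv c v <= 1.
  by move=> vs; apply/pc/sub_convex_hull.
have := h _ (evec_point i); have := h _ (stacked_points_opp (evec_point i)).
by rewrite dotvNr dotv_evec => ? ->; rewrite lerNl andbT.
Qed.

Lemma polar_sum : -2 <= \sum_i c 0 i <= 2.
Proof.
have h v : v \in stacked_points -> dotv c v <= 1.
  by move=> vs; apply/pc/sub_convex_hull.
have := h _ half_point; have := h _ (stacked_points_opp half_point).
by rewrite dotvNr dotv_half => ? ?; apply/andP; split; lra.
Qed.

(* Three coordinates equal to 1 or -1 have an odd sum, so if all four sum to
   2 or -2 then the fourth one is an odd integer as well. *)
Lemma polar_parity j : (\sum_i c 0 i) ^+ 2 = 4 ->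
  (forall i, i != j -> c 0 i ^+ 2 = 1) -> c 0 j ^+ 2 = 1.
Proof.
move=> S4 c1; have [m mE] : exists m : nat,
    \sum_(i < 4 | i != j) c 0 i = 3 - 2 * m%:R.
  (* [m] counts the entries -1 among the three coordinates other than [j]. *)
  exists (\sum_(i < 4 | i != j) (c 0%R i == -1)%R)%N.
  have -> : 3 = \sum_(i < 4 | i != j) (1 : R).
    by rewrite sumr_const (eq_card (B := predC1 j)) // cardC1 card_ord.
  rewrite natr_sum mulr_sumr -sumrB; apply: eq_bigr => i /c1/eqP.
  rewrite -subr_eq0 subr_sqr_1 mulf_eq0 subr_eq0 addr_eq0 => /orP[] /eqP ->.
    have -> : (1 == -1 :> R) = false by apply/eqP; lra.
    by rewrite mulr0 subr0.
  by rewrite eqxx mulr1; lra.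
have := polar_coord j => /andP[l u]; move: S4; rewrite (bigD1 j) //= mE.
move/eqP; rewrite (_ : 4 = 2 ^+ 2 :> R); last by rewrite -natrX.
rewrite eqf_sqr => S4.
(* The total is 2 or -2, and subtracting [3 - 2m] gives these values. The bounds on [c 0 j] leave m
   = 0, 1 in the first case and m = 2, 3 in the second. *)
have [cE|cE] : c 0 j = 2 * m%:R - 1 \/ c 0 j = 2 * m%:R - 5.
  by case/orP: S4 => /eqP S4; [left|right]; lra.
- case: m {mE S4} cE => [|[|m]] cE; [rewrite cE; ring| rewrite cE; ring|].
  have := ler0n R m; move: cE; rewrite -(addn2 m) natrD; lra.
- case: m {mE S4} cE => [|[|[|[|m]]]] cE; [lra|lra|rewrite cE; ring|rewrite cE; ring|].
  have := ler0n R m; move: cE; rewrite -(addn4 m) natrD; lra.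
Qed.

(** From each pair of opposite generators at most one lies on the hyperplane, which leaves five
    candidates. If some coordinate is not a sign, its axis drops out; then either the pair of half
    points drops out too, or parity removes a second axis. *)
Lemma cap_cases : (forall i, c 0 i ^+ 2 = 1) \/
  exists X : seq 'rV[R]_4, size X = 3%N /\
    forall v, v \in stacked_points -> dotv c v = 1 -> v \in X.
Proof.
have [/forallP c1|] := boolP [forall i, c 0 i ^+ 2 == 1].
  by left => i; apply/eqP.
rewrite negb_forall => /existsP[j cj]; right.
pose sig := (\sum_i c 0 i) / 2.
have points v : v \in stacked_points -> dotv c v = 1 ->
    v = sig *: half /\ sig ^+ 2 = 1 \/
    exists2 i, v = c 0 i *: evec i & c 0 i ^+ 2 = 1.
  move=> /stacked_pointsP[w [->|[i ->]] [->|->]];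
    rewrite ?dotvNr ?dotv_half ?dotv_evec -/sig => E.
  - by left; rewrite E scale1r expr1n.
  - by left; rewrite -[sig]opprK E scaleN1r sqrrN expr1n.
  - by right; exists i; rewrite E ?scale1r ?expr1n.
  - by right; exists i; rewrite -[c 0 i]opprK E ?scaleN1r ?sqrrN ?expr1n.
have uI := enum_uniq 'I_4; have sI : size (enum 'I_4) = 4%N by rewrite size_enum_ord.
have jI : j \in enum 'I_4 by rewrite mem_enum.
have [s1|sN] := eqVneq (sig ^+ 2) 1; last first.
  exists [seq c 0 i *: evec i | i <- rem j (enum 'I_4)]; split.
    by rewrite size_map size_rem // sI.
  move=> v /points h /h[[_ s1]|[i -> ci]]; first by rewrite s1 eqxx in sN.
  apply: map_f; rewrite mem_rem_uniq // !inE mem_enum andbT.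
  by apply: contraNneq cj => <-; rewrite ci.
(* A half point lies on the hyperplane, so the coordinates sum to 2 or -2; by [polar_parity], [j]
   cannot be the only coordinate that is not a sign. *)
have [k kj ck] : exists2 k, k != j & c 0 k ^+ 2 != 1.
  apply: contrapT => h; move/eqP: cj; apply; apply: polar_parity.
    by move: s1; rewrite /sig exprMn => s1; nra.
  by move=> i ij; apply/eqP/contraT => ci; case: h; exists i.
exists (sig *: half :: [seq c 0 i *: evec i | i <- rem k (rem j (enum 'I_4))]).
have kI : k \in rem j (enum 'I_4) by rewrite mem_rem_uniq // !inE mem_enum kj.
split.
  by rewrite /= size_map !size_rem // sI.
move=> v /points h /h[[-> _]|[i -> ci]]; first exact: mem_head.
rewrite in_cons; apply/orP; right; apply: map_f.
rewrite mem_rem_uniq ?rem_uniq // inE mem_rem_uniq // !inE mem_enum andbT.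
by apply/andP; split; [apply: contraNneq ck|apply: contraNneq cj] => <-; rewrite ci.
Qed.

Lemma cap_stacked_cross :
  cap P c = convex_hull ([set` stacked_points] `&` [set v | dotv c v = 1]).
Proof.
by rewrite /cap convex_hull_face // => v vs; apply/pc/sub_convex_hull.
Qed.

Lemma dim_cap_signs :
  (forall i, c 0 i ^+ 2 = 1) -> \dim (lspan (cap P c)) = 4%N.
Proof.
move=> c1; apply: dim_evecs => i.
have /eqP := c1 i; rewrite -subr_eq0 subr_sqr_1 mulf_eq0 subr_eq0 addr_eq0.
move=> /orP[] /eqP ci.
  apply: mem_lspan; split; first exact/sub_convex_hull/evec_point.
  by rewrite /= dotv_evec.
rewrite -memvN; apply: mem_lspan; split.
  exact/sub_convex_hull/stacked_points_opp/evec_point.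
by rewrite /= dotvNr dotv_evec ci opprK.
Qed.

End Cap.

Lemma stacked_cross_cap k F : kfaces P k F ->
  exists c, [/\ polar P c, F = cap P c & \dim (lspan (cap P c)) = k.+1].
Proof.
move=> [fF dF [_ PF]]; have F0 := has_dim_nonempty dF.
have [|c pc FE] := symmetric_face_cap stacked_cross_opp fF F0.
  by move=> E; apply: PF; rewrite E.
by exists c; split => //; apply/has_dim_cap; rewrite -FE.
Qed.

(** A facet has linear dimension 4 and is not spanned by three points, so its functional is a sign
    vector; one of the 2 ^ 4 sign vectors is ruled out. *)
Lemma stacked_cross_facets : (#|` fset_set (kfaces P 3)| <= 15)%N.
Proof.
pose sgn (A : {set 'I_4}) : 'rV[R]_4 := \row_i (if i \in A then 1 else -1).
have <- : size [seq cap P (sgn A) | A <- enum [set~ [set: 'I_4]]%SET] = 15%N.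
  by rewrite size_map -cardE cardsC1 -cardsT -powersetT card_powerset cardsT card_ord.
apply: card_fset_set_le; first exact/finite_kfaces/stacked_cross_polytope.
move=> _ /stacked_cross_cap[c [pc -> dc]].
have [c1|[X [sX XP]]] := cap_cases pc; last first.
  suff : (\dim (lspan (cap P c)) <= size X)%N by rewrite dc sX.
  rewrite cap_stacked_cross // lspan_convex_hull.
  by apply: dim_lspan_seq => v [/= vs cv]; apply: XP.
have cE : c = sgn [set i | c 0 i == 1]%SET.
  apply/rowP => i; rewrite mxE inE; have /eqP := c1 i.
  rewrite -subr_eq0 subr_sqr_1 mulf_eq0 subr_eq0 addr_eq0.
  by case: eqP => //= _ /eqP.
rewrite {1}cE; apply/mapP; exists [set i | c 0 i == 1]%SET => //.
(* The all-ones vector has coordinate sum 4, above the bound 2 imposed by [half]. *)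
rewrite mem_enum !inE; apply/negP => /eqP AT.
have := polar_sum pc; rewrite (eq_bigr (fun=> 1)); last first.
  by move=> i _; have := finset.in_setT i; rewrite -AT inE => /eqP.
by rewrite sumr_const card_ord ler_nat andbF.
Qed.

(** A 2-face has linear dimension 3, whereas the cap of a sign vector has 4, so at most three
    generators lie on it. *)
Lemma stacked_cross_triangles F : kfaces P 2 F ->
  exists X : seq 'rV[R]_4, (size X <= 3)%N /\
    forall v, F v -> is_face P [set v] -> v \in X.
Proof.
move=> /stacked_cross_cap[c [pc -> dc]].
have [/dim_cap_signs|[X [sX XP]]] := cap_cases pc; first by rewrite dc.
exists X; rewrite sX; split => // v [_ cv] /face_convex_hull[d [b [_ vE]]].
apply: XP cv.
(* A vertex is the hull of the generators on it, hence is itself a generator. *)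
set W := _ `&` _ in vE.
have /convex_hull_nonempty[w Ww] : convex_hull W v by rewrite -vE.
suff <- : w = v by case: Ww.
by have := sub_convex_hull Ww; rewrite -vE.
Qed.

End Counterexample.

Theorem theorem1p2 (R : realType) :
  exists P : set 'rV[R]_4,
    [/\ is_dpolytope 4 P, centrally_symmetric P
      & forall (n : nat) (H : set 'rV[R]_n), hanner H -> has_dim H 4 ->
        exists alpha : {set 'I_4} -> R,
          nonneg_functionals 4 alpha /\
          flag_functional alpha P < flag_functional alpha H].
Proof.
have pP := stacked_cross_polytope R.
exists (@stacked_cross R); split.
- by split; [|exact: stacked_cross_dim].
- exact: stacked_cross_symmetric.
move=> n H /hanner_hanner_inv[d hH] dH; have pH := hi_polytope hH.
have d4 := has_dim_unique (hi_dim hH) dH.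
case: (hi_quad hH) => [[_ [F [s [fF dF us s4 sF]]]]|[T [c [pc dc ic]]]].
  (* With [k = 2], [simplex_excess] is f_02 - 3 f_2. *)
  pose k : 'I_4 := Ordinal (isT : (2 < 4)%N).
  exists (@simplex_excess R 3 k); split; first exact: simplex_excess_nonneg.
  apply: (@le_lt_trans _ _ 0).
    by apply: simplex_excess_le0 => // G; apply: stacked_cross_triangles.
  apply: (simplex_excess_gt0 _ pH (F := F) (s := s)) => //; last by rewrite s4.
  exact: proper_face fF dF dH _.
(* Here the functional is f_3, with at least 2 ^ 4 facets on [H] against at most 15 on the
   example. *)
rewrite d4 in dc * => T16; pose k : 'I_4 := ord_max.
exists (fun S => (S == [set k]%SET)%:R); split; first exact: flag_number_nonneg.
rewrite !flag_functional_delta ltr_nat !flag_number1 //.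
apply: leq_ltn_trans (stacked_cross_facets R) _.
apply: leq_trans T16 _; rewrite cardE -(size_map (fun t => cap H (c t))).
apply: card_fset_set_ge; first exact: finite_kfaces.
  by rewrite map_inj_uniq ?enum_uniq.
move=> _ /mapP[t _ ->]; apply: proper_face (dc t) dH _ => //.
exact: cap_face.
Qed.
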